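(* Let $X_1,\dots,X_n$ ($n\ge d+1$) be i.i.d. $d$-dimensional random vectors whose distribution is absolutely continuous with respect to Lebesgue measure, with scaled residuals $Y_{n,1},\dots,Y_{n,n}$, and for $\gamma>0$ let $\widetilde T_{n,\gamma}$ be the statistic defined in the context. Then (on the almost sure event that the sample covariance matrix is invertible) $$\lim_{\gamma\to\infty}\gamma^{2+d/2}\,\frac{16\,\widetilde T_{n,\gamma}}{\sqrt n\,\pi^{d/2}}=b_{2,d}-d(d+2),\qquad\text{where}\qquad b_{2,d}=\frac1n\sum_{j=1}^n\|Y_{n,j}\|^4.$$
   Context: Let $\overline X_n=n^{-1}\sum_{j=1}^nX_j$ and $S_n=n^{-1}\sum_{j=1}^n(X_j-\overline X_n)(X_j-\overline X_n)^\top$. For $n\ge d+1$ the matrix $S_n$ is invertible almost surely, $S_n^{-1/2}$ denotes the symmetric positive definite square root of $S_n^{-1}$, and the scaled residuals are $Y_{n,j}=S_n^{-1/2}(X_j-\overline X_n)$, $j=1,\dots,n$. Put $$R_n(t)=\frac1n\sum_{j=1}^n\cos(t^\top Y_{n,j}),\quad M_n(t)=\frac1n\sum_{j=1}^n\exp(t^\top Y_{n,j}),\quad U_n(t)=\sqrt n\,(R_n(t)M_n(t)-1),\quad t\in\mathbb{R}^d,$$ and, for $\gamma>0$, $w_\gamma(t)=\exp(-\gamma\|t\|^2)$ and $$\widetilde T_{n,\gamma}=\int_{\mathbb{R}^d}U_n(t)\,w_\gamma(t)\,dt.$$ $\|\cdot\|$ is the Euclidean norm. *)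

(* Defs.v *)
From HB Require Import structures.
From mathcomp Require Import all_boot all_order all_algebra.
From mathcomp Require Import all_classical all_reals all_analysis.

Set Implicit Arguments.
Unset Strict Implicit.
Unset Printing Implicit Defensive.

Import Order.TTheory GRing.Theory Num.Theory.
Import numFieldNormedType.Exports.

Local Open Scope classical_set_scope.
Local Open Scope ring_scope.

Section lebesgue_measure_on_tuples.
Context {R : realType}.
Implicit Type d : nat.

Definition tuple_cons d (p : d.-tuple R * measurableTypeR R) : d.+1.-tuple R :=
  [tuple of p.2 :: p.1].

Lemma measurable_tuple_cons d : measurable_fun setT (@tuple_cons d).
Proof. exact: (measurable_cons (f := snd) (g := fst)). Qed.

Section one_more_coordinate.
Context d (mu : {measure set (d.-tuple R) -> \bar R}).

Definition add_coordinate : set (d.+1.-tuple R) -> \bar R :=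
  pushforward (mu \x @lebesgue_measure R)%E (@tuple_cons d).

Let add_coordinate0 : add_coordinate set0 = 0%E.
Proof. by rewrite /add_coordinate /pushforward preimage_set0 measure0. Qed.

Let add_coordinate_ge0 A : (0 <= add_coordinate A)%E.
Proof. by rewrite /add_coordinate /pushforward measure_ge0. Qed.

Let add_coordinate_sigma_additive : semi_sigma_additive add_coordinate.
Proof.
apply: (measure_semi_sigma_additive (s := pushforward _ _)).
exact: measurable_tuple_cons.
Qed.

HB.instance Definition _ := isMeasure.Build _ _ _ add_coordinate
  add_coordinate0 add_coordinate_ge0 add_coordinate_sigma_additive.

End one_more_coordinate.

(* The Lebesgue measure of R^d, with R^d represented by d.-tuple R and its
   product sigma-algebra: the d-fold product of the Lebesgue measure of R
   (R^0 is a point of mass 1). *)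
Fixpoint lebesgue_tuple d : {measure set (d.-tuple R) -> \bar R} :=
  if d is d'.+1 then add_coordinate (lebesgue_tuple d')
  else \d_([tuple] : 0.-tuple R).

Lemma lebesgue_tuple_box d (A : 'I_d -> set R) :
    (forall i, measurable (A i)) ->
  lebesgue_tuple d [set t | forall i, A i (tnth t i)] =
  (\prod_(i < d) @lebesgue_measure R (A i))%E.
Proof.
elim: d A => [|d IHd] A mA.
  by rewrite big_ord0 /= diracE mem_set// => -[].
rewrite big_ord_recl muleC -IHd; last by move=> i; exact: mA.
rewrite /= -(product_measure1E (lebesgue_tuple d) lebesgue_measure).
- congr (product_measure1 _ _ _); apply/seteqP; split=> -[t x] /=.
  + move=> At; split; last by have := At ord0; rewrite tnth0.
    by move=> i; have := At (lift ord0 i); rewrite tnthS.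
  + move=> [At Ax] i; case: (unliftP ord0 i) => [j ->|->].
    * by rewrite tnthS; exact: At.
    * by rewrite tnth0.
- rewrite (_ : mkset _ =
      \bigcap_(i in setT) ((@tnth d R ^~ i) @^-1` A (lift ord0 i))).
    apply: fin_bigcap_measurable => [|i _]; first exact: finite_finset.
    by rewrite -[X in measurable X]setTI; exact: measurable_tnth.
  by apply/seteqP; split=> t /= At i; [move=> _|]; exact: At.
- exact: mA.
Qed.

End lebesgue_measure_on_tuples.

Definition mutually_independent d d' (T : measurableType d)
    (T' : measurableType d') (R : realType) (P : probability T R) (n : nat)
    (X : 'I_n -> {RV P >-> T'}) : Prop :=
  forall (J : {set 'I_n}) (A : 'I_n -> set T'),
    (forall j, measurable (A j)) ->
    P (\bigcap_(j in [set` J]) (X j @^-1` A j)) =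
    (\prod_(j in J) P (X j @^-1` A j))%E.

Definition identically_distributed d d' (T : measurableType d)
    (T' : measurableType d') (R : realType) (P : probability T R) (n : nat)
    (X : 'I_n -> {RV P >-> T'}) : Prop :=
  forall (i j : 'I_n) (A : set T'), measurable A ->
    distribution P (X i) A = distribution P (X j) A.

Section residuals.
Context {R : realType}.

Definition vec_of_tuple d (t : d.-tuple R) : 'cV[R]_d := \col_i tnth t i.

Definition dotv d (u v : 'cV[R]_d) : R := (u^T *m v) 0 0.

(* The norm `| _ | of the library on matrices is the sup norm. *)
Definition enorm d (u : 'cV[R]_d) : R := Num.sqrt (\sum_(i < d) u i 0 ^+ 2).

Definition is_spd d (A : 'M[R]_d) : Prop :=
  A^T = A /\ forall u : 'cV[R]_d, u != 0 -> 0 < (u^T *m A *m u) 0 0.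

(* The symmetric positive definite square root of A; it exists and is unique
   for A symmetric positive definite, and the value is 0 if there is none. *)
Definition sqrtmx_spd d (A : 'M[R]_d) : 'M[R]_d :=
  xget 0 [set B | is_spd B /\ B *m B = A].

Section sample.
Context (d n : nat) (x : 'I_n -> 'cV[R]_d).

Definition sample_mean : 'cV[R]_d := n%:R^-1 *: \sum_(j < n) x j.

Definition sample_cov : 'M[R]_d :=
  n%:R^-1 *: \sum_(j < n) (x j - sample_mean) *m (x j - sample_mean)^T.

Definition scaled_residual (j : 'I_n) : 'cV[R]_d :=
  sqrtmx_spd (invmx sample_cov) *m (x j - sample_mean).

Definition empirical_cos (t : 'cV[R]_d) : R :=
  n%:R^-1 * \sum_(j < n) cos (dotv t (scaled_residual j)).

Definition empirical_mgf (t : 'cV[R]_d) : R :=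
  n%:R^-1 * \sum_(j < n) expR (dotv t (scaled_residual j)).

Definition U_stat (t : 'cV[R]_d) : R :=
  Num.sqrt n%:R * (empirical_cos t * empirical_mgf t - 1).

Definition gauss_weight (gamma : R) (t : 'cV[R]_d) : R :=
  expR (- gamma * enorm t ^+ 2).

Definition T_stat (gamma : R) : R :=
  \int[lebesgue_tuple d]_t
    (U_stat (vec_of_tuple t) * gauss_weight gamma (vec_of_tuple t)).

Definition mardia_kurtosis : R :=
  n%:R^-1 * \sum_(j < n) enorm (scaled_residual j) ^+ 4.

End sample.

End residuals.

Definition observed d (T : measurableType d) (R : realType)
    (P : probability T R) (k n : nat) (X : 'I_n -> {RV P >-> k.-tuple R})
    (w : T) (j : 'I_n) : 'cV[R]_k :=
  vec_of_tuple (X j w).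

(* Main.v *)
(* Almost sure invertibility: the empirical covariance matrix is singular only if
   the sample lies in a hyperplane.  By induction on k, the vectors (1, X_i) of
   k <= d + 1 sample points are almost surely linearly independent: given the
   first ones, the next point would have to lie on a fixed hyperplane, which is a
   null set, and by independence Fubini applies.

   Limit: the Gaussian integral of cos(t.a) exp(t.b) is explicit, which gives
     T_gamma = sqrt n (pi / gamma)^(d/2)
       (n^-2 sum_{j,k} exp(s (|Y_k|^2 - |Y_j|^2)) cos(2 s Y_j.Y_k) - 1)
   with s = 1 / (4 gamma).  The claim is the expansion of the bracket to second
   order in s: the first order term vanishes by symmetry, and the second order
   term is computed from the whitening identity sum_j Y_j Y_j^T = n I. *)

From HB Require Import structures.
From mathcomp Require Import all_boot all_order all_algebra.
From mathcomp Require complex.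
From mathcomp Require Import all_classical all_reals all_analysis measurable_realfun.
From mathcomp Require Import ring lra.
Require Import Defs.

Set Implicit Arguments.
Unset Strict Implicit.
Unset Printing Implicit Defensive.

Import Order.TTheory GRing.Theory Num.Theory.
Import numFieldNormedType.Exports.

Local Open Scope classical_set_scope.
Local Open Scope ring_scope.

(** * Square roots of positive definite matrices *)

(** [sqrtmx_spd] is a choice with default value 0, so the residuals are out of reach until a
    positive definite square root is shown to exist; the spectral part serves this purpose. On the
    analytic side, changes of variables and Tonelli are applied to nonnegative integrands only,
    whereas cosines change sign. This shapes the Gaussian formulas: they are proved for [p + q cos]
    with [0 <= q <= p], or after adding 1 to a function bounded by 1, and the cosine is recovered by
    subtraction. The one-dimensional Fourier transform itself comes from the differential equation
    [f' = - (a / 2) f]. *)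

Lemma lagrange_interpolation (F : fieldType) (s : seq F) (v : F -> F) :
  exists p : {poly F}, forall x, x \in s -> p.[x] = v x.
Proof.
elim: s => [|a s [p pv]]; first by exists 0 => x; rewrite in_nil.
have [as_|as_] := boolP (a \in s).
  by exists p => x; rewrite inE => /orP[/eqP->|]; exact: pv.
pose q := \prod_(b <- s) ('X - b%:P).
have qa : q.[a] != 0 by rewrite -/(root q a) root_prod_XsubC.
exists (p + ((v a - p.[a]) / q.[a]) *: q) => x.
rewrite inE hornerD hornerZ => /orP[/eqP->|xs].
  by rewrite divfK// addrC subrK.
have -> : q.[x] = 0 by apply/eqP; rewrite -/(root q x) root_prod_XsubC.
by rewrite mulr0 addr0; exact: pv.
Qed.

Lemma trmx_horner_mx (F : comNzRingType) n (A : 'M[F]_n.+1) (p : {poly F}) :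
  (horner_mx A p)^T = horner_mx A^T p.
Proof.
elim/poly_ind: p => [|p c IH]; first by rewrite !raddf0.
rewrite !rmorphD !rmorphM/= !horner_mx_X !horner_mx_C raddfD/= tr_scalar_mx.
by rewrite trmx_mul IH; congr (_ + _); exact: comm_mx_horner.
Qed.

Section spd_sqrt.
Import complex.
Context {R : realType}.
Local Notation toC := (real_complex R).

Lemma quadratic_form_tr n (A : 'M[R]_n) (u : 'cV[R]_n) :
  (u^T *m (A^T *m A) *m u) 0 0 = \sum_i (A *m u) i 0 ^+ 2.
Proof.
rewrite !mulmxA -trmx_mul -mulmxA mxE; apply: eq_bigr => i _.
by rewrite mxE expr2.
Qed.

Lemma spd_unit n (A : 'M[R]_n) : is_spd A -> A \in unitmx.
Proof.
move=> [sA pA]; rewrite -row_free_unit; apply/inj_row_free => v vA.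
apply/eqP/negPn/negP => v0.
have /pA : v^T != 0 by rewrite -trmx0 (inj_eq (@trmx_inj _ _ _)).
by rewrite trmxK vA mul0mx mxE ltxx.
Qed.

(** Over [R[i]] the real symmetric [A] is hermitian, so the spectral theorem applies and its
    eigenvalues are real. Positivity of [A] is known on real vectors only, hence the passage from a
    complex eigenvector to its real or imaginary part. *)
Lemma spd_diagonalizable n (A : 'M[R]_n.+1) : is_spd A ->
  exists (P : 'M[R[i]]_n.+1) (r : 'I_n.+1 -> R), [/\ P \in unitmx,
    forall i, 0 < r i &
    map_mx toC A = invmx P *m diag_mx (\row_i (toC (r i))) *m P].
Proof.
move=> [sA pA]; set AC := map_mx toC A.
have symAC : AC \is symmetricmx.
  apply/is_hermitianmxP; rewrite expr0 scale1r map_mx_id// /AC -[in LHS]sA.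
  by apply/matrixP => i j; rewrite !mxE.
have realAC : AC \is a realmx.
  by apply/mxOverP => i j; rewrite mxE complex_real.
have hAC := realsym_hermsym symAC realAC.
have /hermitian_normalmx /orthomx_spectralP ACE := hAC.
have Dreal := hermitian_spectral_diag_real hAC.
set P := spectralmx AC in ACE *.
set D := spectral_diag AC in ACE Dreal *.
have Pu : P \in unitmx by exact: spectral_unit.
pose r i := complex.Re (D 0 i).
have DE : D = \row_i toC (r i).
  apply/rowP => i; rewrite mxE /r.
  by have /mxOverP/(_ 0 i)/complex_realP[x ->] := Dreal.
exists P, r; split; [exact: Pu| |by rewrite -DE].
move=> i; have PA : P *m AC = diag_mx D *m P by rewrite ACE !mulmxA mulmxV// mul1mx.
(* [A] and [r i] are real, so an [R]-linear map such as [Re] or [Im], applied entrywise, sends row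
   [i] of [P] to a row satisfying the same eigenvalue equation. *)
have key (g : {additive R[i] -> R}) : (forall x z, g (toC x * z) = x * g z) ->
    let w := \row_k g (P i k) in w *m A = r i *: w.
  move=> gZ; apply/rowP => j; have := congr1 (fun M : 'M[R[i]]_n.+1 => g (M i j)) PA.
  rewrite mul_diag_mx !mxE DE mxE gZ => <-; rewrite raddf_sum; apply: eq_bigr => k _.
  by rewrite !mxE mulrC -gZ mulrC.
have keypos (w : 'rV_n.+1) : w *m A = r i *: w -> w != 0 -> 0 < r i.
  move=> wA w0; have := pA w^T; rewrite trmxK wA -scalemxAl mxE.
  have w0' : w^T != 0 by rewrite -trmx0 (inj_eq (@trmx_inj _ _ _)).
  move=> /(_ w0'); apply: contraTT; rewrite -!leNgt => ri.
  rewrite mulr_le0_ge0// mxE sumr_ge0// => k _.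
  by rewrite mxE -expr2 sqr_ge0.
have [w0|w0] := eqVneq (\row_k complex.Re (P i k)) 0; last first.
  by apply: keypos w0; apply: (key (@complex.Re R)) => x [a b] /=; rewrite mul0r subr0.
have [v0|v0] := eqVneq (\row_k complex.Im (P i k)) 0; last first.
  by apply: keypos v0; apply: (key (@complex.Im R)) => x [a b] /=; rewrite mul0r addr0.
(* If both parts vanished, row [i] of the invertible [P] would be zero. *)
exfalso; have : row i P = 0.
  apply/rowP => k; have := congr1 (fun v : 'rV[R]_n.+1 => v 0 k) w0.
  have := congr1 (fun v : 'rV[R]_n.+1 => v 0 k) v0.
  by rewrite !mxE; case: (P i k) => a b /= -> ->.
move/(congr1 (fun v => v *m invmx P)); rewrite -row_mul mulmxV// mul0mx.
move/rowP/(_ i); rewrite !mxE eqxx => /eqP; rewrite oner_eq0//.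
Qed.

(* [B] is a square [C^2], where [C = q(A)] for a real polynomial [q]
   interpolating the fourth root on the spectrum of [A]: this makes [B]
   symmetric, and positive because [u^T B u = |C u|^2]. *)
Lemma spd_sqrt_exists n (A : 'M[R]_n) : is_spd A ->
  exists B, is_spd B /\ B *m B = A.
Proof.
case: n A => [|n] A spdA.
  by exists A; split=> //; rewrite flatmx0 [A]flatmx0.
have [P [r [Pu r0 AE]]] := spd_diagonalizable spdA.
have [q qr] := lagrange_interpolation [seq r i | i <- enum 'I_n.+1]
  (fun x => Num.sqrt (Num.sqrt x)).
pose C := horner_mx A q.
have C4 : C ^+ 4 = A.
  rewrite /C -rmorphXn/=; apply: (@map_mx_inj _ _ toC).
  rewrite map_horner_mx/= AE horner_mx_uconjC//.
  congr (_ *m _ *m _); rewrite horner_mx_diag; congr diag_mx.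
  apply/rowP => i; rewrite !mxE horner_map/= hornerE.
  rewrite qr ?map_f ?mem_enum//; congr toC.
  by rewrite -[4%N]/(2 * 2)%N exprM !sqr_sqrtr ?sqrtr_ge0// ltW.
have sC : C^T = C by rewrite /C trmx_horner_mx spdA.1.
have Cu : C \in unitmx.
  by have := spd_unit spdA; rewrite -C4 [_ \in unitmx]unitrX_pos.
exists (C *m C); split; last by rewrite -[RHS]C4 !exprS expr0 mulr1 -mulmxA.
split; first by rewrite trmx_mul sC.
move=> u u0; rewrite -{1}sC quadratic_form_tr lt_neqAle sumr_ge0 ?andbT; last first.
  by move=> *; exact: sqr_ge0.
rewrite eq_sym psumr_eq0; last by move=> *; exact: sqr_ge0.
apply: contra u0 => /allP Cu0.
have : C *m u = 0.
  apply/matrixP => i j; rewrite ord1 [RHS]mxE.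
  by have := Cu0 i (mem_index_enum _); rewrite sqrf_eq0 => /eqP.
by move/(congr1 (mulmx (invmx C))); rewrite mulmx0 mulKmx// => ->.
Qed.

End spd_sqrt.

(** * Scaled residuals *)

Lemma enorm_sqr (R : realType) d (u : 'cV[R]_d) : enorm u ^+ 2 = dotv u u.
Proof.
rewrite sqr_sqrtr ?sumr_ge0// => [|i _]; last exact: sqr_ge0.
by rewrite /dotv mxE; apply: eq_bigr => i _; rewrite mxE expr2.
Qed.

Lemma dotvC (R : realType) d (u v : 'cV[R]_d) : dotv u v = dotv v u.
Proof. by rewrite /dotv -[v in LHS]trmxK -trmx_mul mxE. Qed.

Lemma mul_outer_dotv (R : realType) d (u a b v : 'cV[R]_d) :
  (u^T *m (a *m b^T) *m v) 0 0 = dotv u a * dotv b v.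
Proof. by rewrite mulmxA -(mulmxA (u^T *m a)) mxE big_ord1. Qed.

Section whitening.
Context {R : realType} (d n : nat) (x : 'I_n -> 'cV[R]_d).
Hypothesis n0 : (0 < n)%N.
Hypothesis Su : sample_cov x \in unitmx.
Local Notation S := (sample_cov x).
Local Notation Y := (scaled_residual x).

Let n0' : n%:R != 0 :> R. Proof. by rewrite pnatr_eq0 -lt0n. Qed.

Lemma sample_cov_tr : S^T = S.
Proof.
rewrite /sample_cov linearZ/= raddf_sum/=; congr (_ *: _); apply: eq_bigr => j _.
by rewrite trmx_mul trmxK.
Qed.

Lemma sample_cov_form (u : 'cV[R]_d) :
  (u^T *m S *m u) 0 0 = n%:R^-1 * \sum_j dotv u (x j - sample_mean x) ^+ 2.
Proof.
rewrite /sample_cov -scalemxAr -scalemxAl mxE; congr (_ * _).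
rewrite mulmx_sumr mulmx_suml summxE; apply: eq_bigr => j _.
by rewrite mul_outer_dotv (dotvC _ u) expr2.
Qed.

(** The form is a mean of squares. If it vanishes at [u], then [u] is orthogonal to all centred
    points, so [S u = 0], and invertibility gives [u = 0]. *)
Lemma sample_cov_spd : is_spd S.
Proof.
split=> [|u u0]; first exact: sample_cov_tr.
have ge0 j : true -> 0 <= dotv u (x j - sample_mean x) ^+ 2 by rewrite sqr_ge0.
rewrite lt_neqAle sample_cov_form mulr_ge0 ?invr_ge0 ?sumr_ge0// andbT eq_sym.
rewrite mulf_eq0 invr_eq0 (negbTE n0')/= psumr_eq0//.
apply: contra u0 => /allP/= du.
suff : S *m u = 0 by move/(congr1 (mulmx (invmx S))); rewrite mulmx0 mulKmx// => ->.
rewrite /sample_cov -scalemxAl mulmx_suml big1 ?scaler0// => j _.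
rewrite -mulmxA (_ : _ *m u = 0) ?mulmx0//; apply/matrixP => a b; rewrite !ord1.
have := du j (mem_index_enum _); rewrite sqrf_eq0 dotvC => /eqP.
by rewrite /dotv mxE => ->; rewrite mxE.
Qed.

Lemma invmx_spd (A : 'M[R]_d) : is_spd A -> is_spd (invmx A).
Proof.
move=> spdA; have Au := spd_unit spdA; have [sA pA] := spdA.
have sI : (invmx A)^T = invmx A by rewrite trmx_inv sA.
split=> // u u0; have Iu0 : invmx A *m u != 0.
  by apply: contra u0 => /eqP/(congr1 (mulmx A)); rewrite mulmx0 mulKVmx// => ->.
by have := pA _ Iu0; rewrite trmx_mul sI -!mulmxA mulKVmx.
Qed.

Lemma residual_second_moment : \sum_j Y j *m (Y j)^T = n%:R *: 1%:M.
Proof.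
(* Existence of a root guarantees that [xget] returns one, and not its default 0. *)
have [[sB pB] B2] := xgetPex 0 (spd_sqrt_exists (invmx_spd sample_cov_spd)).
rewrite -/(sqrtmx_spd _) in sB pB B2.
set B := sqrtmx_spd (invmx S) in sB pB B2.
have Bu : B \in unitmx by exact: spd_unit.
have -> : \sum_j Y j *m (Y j)^T = n%:R *: (B *m S *m B).
  rewrite /sample_cov -scalemxAr -scalemxAl scalerA divff// scale1r.
  rewrite mulmx_sumr mulmx_suml; apply: eq_bigr => j _.
  by rewrite /scaled_residual trmx_mul -/B sB !mulmxA.
(* After multiplication by [B] on the left, [B B S B = S^-1 S B = B]; cancelling [B] leaves
   [B S B = I]. *)
congr (_ *: _); apply: (can_inj (mulKmx Bu)).
by rewrite mulmx1 !mulmxA B2 mulVmx// mul1mx.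
Qed.

Lemma sum_sqr_residual : \sum_j dotv (Y j) (Y j) = n%:R * d%:R.
Proof.
have := congr1 mxtrace residual_second_moment.
rewrite linearZ/= mxtrace1 raddf_sum/= => <-; apply: eq_bigr => j _.
by rewrite mxtrace_mulC /mxtrace big_ord1.
Qed.

(** For fixed [j], the inner sum is the quadratic form of [\sum_k Y k (Y k)^T = n I] at [Y j], that
    is [n |Y j|^2]. *)
Lemma sum_sqr_dotv_residual :
  \sum_j \sum_k dotv (Y j) (Y k) ^+ 2 = n%:R ^+ 2 * d%:R.
Proof.
rewrite expr2 -mulrA -sum_sqr_residual mulr_sumr; apply: eq_bigr => j _.
rewrite /dotv -[RHS]mulr1 -[in RHS](mulmx1 (Y j)^T).
transitivity (((Y j)^T *m (\sum_k Y k *m (Y k)^T) *m Y j) 0 0).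
  rewrite mulmx_sumr mulmx_suml summxE; apply: eq_bigr => k _.
  by rewrite mul_outer_dotv (dotvC _ (Y j)) expr2.
by rewrite residual_second_moment -scalemxAr -scalemxAl mulr1 mxE.
Qed.

End whitening.

(** * One-dimensional Gaussian integrals *)

Section gauss_characteristic_function.
Context {R : realType}.
Local Notation mu := (@lebesgue_measure R).

(** Used twice: with [k = 1] it is translation invariance, and with [k = sqrt g], [m = b / (2 g)] it
    completes the square. *)
Lemma ge0_integral_affine (G : R -> R) (k m : R) : 0 < k ->
  continuous G -> (forall x, 0 <= G x) ->
  (\int[mu]_x (G x)%:E = k%:E * \int[mu]_x (G (k * (x - m)))%:E)%E.
Proof.
move=> k0 cG G0; pose F x : R := k * (x - m).
have dF (x : R) : is_derive x 1 F k.
  apply: is_derive_eq.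
  by rewrite subr0 scaler1.
have F'E : F^`()%classic = cst k.
  by apply/funext => x; rewrite derive1E derive_val.
have cF : continuous F by move=> x; apply/differentiable_continuous/derivable1_diffP.
rewrite (@increasing_ge0_integration_by_substitutionT _ F G)//.
- rewrite -ge0_integralZl ?lee_fin ?ltW//.
  + by apply: eq_integral => x _; rewrite F'E !fctE mulrC EFinM.
  + apply/measurable_EFinP.
    apply: (continuous_measurable_fun (f := G \o F)) => x.
    by apply: continuous_comp; [exact: cF|exact: cG].
  + by move=> x _; rewrite lee_fin.
- by move=> x y xy; rewrite /F ltr_pM2l// ltrD2r.
- by rewrite F'E => ?; exact: cvg_cst.
- by rewrite F'E; exact: is_cvg_cst.
- by rewrite F'E; exact: is_cvg_cst.
- by apply: gt0_cvgMrNy => //; exact: cvg_addrr_Ny.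
- by apply: gt0_cvgMry => //; exact: cvg_addrr.
Qed.

(** Up to the factor [normal_peak], this is the centred normal density of variance 2. It dominates
    every differentiation under the integral sign below. *)
Lemma integrable_expR_sqr_div4 :
  mu.-integrable setT (EFin \o (fun x : R => expR (- (x ^+ 2) / 4))).
Proof.
have s0 : Num.sqrt 2 != 0 :> R by rewrite gt_eqF// sqrtr_gt0.
have := integrable_normal_pdf 0 (Num.sqrt 2 : R).
move=> /(integrableZl measurableT (normal_peak (Num.sqrt 2))^-1).
apply: eq_integrable => // x _ /=.
rewrite normal_pdfE// /normal_fun subr0 sqr_sqrtr// -EFinM mulKf.
  by rewrite -mulr_natr -natrM.
by rewrite gt_eqF// normal_peak_gt0.
Qed.

(** A bound uniform in the shift [b], for the shifted Gaussian and for its derivative in [b]. With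
    [y = x - b], half of the exponent [- y^2] absorbs [|y|], and the other half is compared with
    [- x^2 / 4] by [y^2 / 2 - x^2 / 4 = (x / 2 - b)^2 - b^2 / 2 >= - 1]. *)
Lemma gauss_fun_shift_bound (x b : R) : -1 < b < 1 ->
  2 * `|x - b| * gauss_fun (x - b) <= 2 * expR 1 * expR (- (x ^+ 2) / 4) /\
  gauss_fun (x - b) <= 2 * expR 1 * expR (- (x ^+ 2) / 4).
Proof.
move=> /andP[b1 b2]; set y := x - b.
have ye : gauss_fun y <= expR (- (y ^+ 2) / 2) by rewrite ler_expR; nra.
have ly : `|y| * gauss_fun y <= expR (- (y ^+ 2) / 2).
  have -> : gauss_fun y = expR (- (y ^+ 2) / 2) * expR (- (y ^+ 2) / 2).
    by rewrite -expRD; congr expR; field.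
  (* This reduces to [|y| <= exp (y^2 / 2)], which follows from [|y| <= 1 + y^2 / 2]. *)
  rewrite mulrA ler_piMl ?expR_ge0// mulNr expRN ler_pdivrMr ?expR_gt0// mul1r.
  apply: le_trans (expR_ge1Dx _); rewrite -real_normK ?num_real//.
  by have := normr_ge0 y; nra.
have yb : expR (- (y ^+ 2) / 2) <= expR 1 * expR (- (x ^+ 2) / 4).
  rewrite -expRD ler_expR /y.
  have := sqr_ge0 (x / 2 - b); have : b ^+ 2 <= 1 by nra.
  by lra.
have e0 := expR_gt0 (- (y ^+ 2) / 2 : R).
split; first by rewrite -!mulrA ler_pM2l// (le_trans ly).
apply: (le_trans ye); apply: (le_trans yb).
rewrite -mulrA ler_peMl ?mulr_ge0 ?expR_ge0//.
lra.
Qed.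

Lemma integrable_bounded_gauss_shift (h : R -> R) (b : R) : -1 < b < 1 ->
  measurable_fun setT h -> (forall x, `|h x| <= 1) ->
  mu.-integrable setT (EFin \o (fun x => h x * gauss_fun (x - b))).
Proof.
move=> b1 mh h1.
have := integrableZl measurableT (2 * expR 1) integrable_expR_sqr_div4.
apply: le_integrable => //.
  apply/measurable_EFinP; apply: measurable_funM => //.
  apply: measurableT_comp; first exact: measurable_gauss_fun.
  exact: measurable_funB.
move=> x _ /=; rewrite lee_fin normrM (ger0_norm (gauss_fun_ge0 _)).
have [_ le2] := gauss_fun_shift_bound x b1.
apply: le_trans (ler_norm _); apply: le_trans le2.
by rewrite ler_piMl ?gauss_fun_ge0.
Qed.

Lemma integrable_bounded_gauss (h : R -> R) :
  measurable_fun setT h -> (forall x, `|h x| <= 1) ->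
  mu.-integrable setT (EFin \o (fun x => h x * gauss_fun x)).
Proof.
move=> mh h1; have b0 : -1 < (0:R) < 1 by rewrite ltr01 andbT ltrN10.
apply: eq_integrable (integrable_bounded_gauss_shift b0 mh h1) => // x _ /=.
by rewrite subr0.
Qed.

(** Translation is available for nonnegative integrands, so it is applied to [1 + h] and to the
    constant 1, and the results are subtracted. *)
Lemma Rintegral_gauss_shift (h : R -> R) (b : R) : -1 < b < 1 ->
  continuous h -> (forall x, `|h x| <= 1) ->
  (\int[mu]_x (h x * gauss_fun (x - b)) =
   \int[mu]_x (h (x + b)%R * gauss_fun x))%R.
Proof.
move=> b1 ch h1.
have mh : measurable_fun setT h by exact: continuous_measurable_fun.
have chb : continuous (fun x : R => h (x + b)).
  move=> x; apply: (@continuous_comp _ _ _ (fun x : R => x + b) h).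
    by apply: cvgD; [exact: cvg_id|exact: cvg_cst].
  exact: ch.
have mhb : measurable_fun setT (fun x : R => h (x + b)).
  exact: continuous_measurable_fun.
have m1 : measurable_fun setT (cst 1 : R -> R) by exact: measurable_cst.
have h11 (x : R) : `|cst 1 x : R| <= 1 by rewrite normr1.
have b0 : -1 < (0:R) < 1 by rewrite ltr01 andbT ltrN10.
have shift (g : R -> R) : continuous g -> (forall x, 0 <= g x) ->
    \int[mu]_x (g x * gauss_fun (x - b)) = \int[mu]_x (g (x + b) * gauss_fun x).
  move=> cg g0; rewrite /Rintegral.
  rewrite [in RHS](@ge0_integral_affine
    (fun x : R => g (x + b) * gauss_fun x) 1 b) ?ltr01//.
  - by rewrite mul1e; congr fine; apply: eq_integral => x _; rewrite !mul1r subrK.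
  - move=> x; apply: cvgM; last exact: continuous_gauss_fun.
    apply: (@continuous_comp _ _ _ (fun x : R => x + b) g).
      by apply: cvgD; [exact: cvg_id|exact: cvg_cst].
    exact: cg.
  - by move=> x; rewrite mulr_ge0 ?gauss_fun_ge0.
have s1 := shift (cst 1) (fun x => @cvg_cst _ _ _ _ _) (fun=> ler01).
have s2 : \int[mu]_x ((1 + h x) * gauss_fun (x - b)) =
          \int[mu]_x ((1 + h (x + b)) * gauss_fun x).
  apply: (shift (fun x => 1 + h x)) => x.
    by apply: cvgD; [exact: cvg_cst|exact: ch].
  by have := h1 x; rewrite ler_norml; lra.
have I1 := integrable_bounded_gauss_shift b1 m1 h11.
have I2 := integrable_bounded_gauss m1 h11.
have I3 := integrable_bounded_gauss_shift b1 mh h1.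
have I4 := integrable_bounded_gauss mhb (fun x => h1 (x + b)).
move: s2; under eq_Rintegral do rewrite mulrDl.
under [in RHS]eq_Rintegral do rewrite mulrDl.
rewrite (RintegralD measurableT I1 I3) (RintegralD measurableT I2 I4).
by rewrite s1 => /addrI.
Qed.

(** The real part of [exp (i c)] times the Fourier transform of the Gaussian. In dimension [d], the
    phase [c] receives the contribution of the other coordinates. *)
Definition gauss_cos (a c : R) := \int[mu]_x (cos (a * x + c) * gauss_fun x).

Lemma continuous_affine (a c : R) : continuous (fun x : R => a * x + c).
Proof.
by move=> x; apply: cvgD; [apply: cvgM; [exact: cvg_cst|exact: cvg_id]|exact: cvg_cst].
Qed.

Lemma continuous_cos_affine (a c : R) : continuous (fun x : R => cos (a * x + c)).
Proof.
move=> x; apply: (@continuous_comp _ _ _ (fun x : R => a * x + c) cos).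
  exact: continuous_affine.
exact: continuous_cos.
Qed.

Lemma continuous_sin_affine (a c : R) : continuous (fun x : R => sin (a * x + c)).
Proof.
move=> x; apply: (@continuous_comp _ _ _ (fun x : R => a * x + c) sin).
  exact: continuous_affine.
exact: continuous_sin.
Qed.

Lemma normr_cos_le1 (x : R) : `|cos x| <= 1.
Proof. by rewrite ler_norml cos_geN1 cos_le1. Qed.

Lemma normr_sin_le1 (x : R) : `|sin x| <= 1.
Proof. by rewrite ler_norml sin_geN1 sin_le1. Qed.

Lemma is_derive_gauss_fun (x : R) : is_derive x 1 gauss_fun (- 2 * x * gauss_fun x).
Proof.
have dsq : is_derive x 1 (fun y : R => - y ^+ 2) (- 2 * x).
  by apply: is_derive_eq; rewrite /GRing.scale/=; ring.
have := is_derive1_comp (f := expR) (g := fun y : R => - y ^+ 2)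
  (is_derive_expR (- x ^+ 2)) dsq.
by rewrite mulrC.
Qed.

Lemma is_derive_cos_affine (x c a : R) :
  is_derive a 1 (fun a : R => cos (a * x + c)) (- (x * sin (a * x + c))).
Proof.
have daff : is_derive a 1 (fun a : R => a * x + c) x.
  by apply: is_derive_eq; rewrite /GRing.scale/=; ring.
have := is_derive1_comp (f := cos) (g := fun a : R => a * x + c)
  (is_derive_cos (a * x + c)) daff.
by rewrite mulNr mulrC.
Qed.

Lemma derive_gauss_cos (c a : R) :
  is_derive a 1 (gauss_cos ^~ c)
    (- \int[mu]_x (sin (a * x + c) * (x * gauss_fun x))).
Proof.
pose f (a x : R) := cos (a * x + c) * gauss_fun x.
pose G (x : R) := 2 * expR 1 * expR (- (x ^+ 2) / 4).
have dfE (b x : R) : is_derive b 1 (f ^~ x) (- (sin (b * x + c) * (x * gauss_fun x))).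
  have := is_derive_cos_affine x c b => H.
  apply: is_derive_eq.
  by rewrite /GRing.scale/= mulr0 add0r; ring.
have Ia : `]a - 1, a + 1[%classic a by rewrite /= in_itv/=; lra.
have intf (x : R) : `]a - 1, a + 1[%classic x -> mu.-integrable setT (EFin \o f x).
  move=> _; apply: integrable_bounded_gauss => [|y]; last exact: normr_cos_le1.
  by apply: continuous_measurable_fun; exact: continuous_cos_affine.
have derf (x y : R) : `]a - 1, a + 1[%classic x -> setT y -> derivable (f ^~ y) x 1.
  by move=> _ _; have [] := dfE x y; rewrite /f.
have G0 y : 0 <= G y by rewrite !mulr_ge0 ?expR_ge0.
have iG : mu.-integrable setT (EFin \o G).
  exact: eq_integrable
    (integrableZl measurableT (2 * expR 1) integrable_expR_sqr_div4).
have b0 : -1 < (0:R) < 1 by rewrite ltr01 andbT ltrN10.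
have fG (x y : R) : `]a - 1, a + 1[%classic x -> setT y -> `|partial1of2 f x y| <= G y.
  move=> _ _; rewrite partial1of2E.
  have := dfE x y => H; rewrite derive_val normrN normrM.
  have [le1 _] := gauss_fun_shift_bound y b0; rewrite subr0 in le1.
  apply: le_trans le1; rewrite normrM (ger0_norm (gauss_fun_ge0 _)) -mulrA.
  have := normr_sin_le1 (x * y + c).
  have : 0 <= `|y| * gauss_fun y by rewrite mulr_ge0 ?gauss_fun_ge0.
  have := normr_ge0 (sin (x * y + c)); nra.
apply: DeriveDef.
  exact: (derivable_under_integral measurableT Ia intf derf G0 iG fG).
rewrite -derive1E.
rewrite (differentiation_under_integral measurableT Ia intf derf G0 iG fG).
transitivity (\int[mu]_y (- 1 * (sin (a * y + c) * (y * gauss_fun y)))).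
  apply: eq_Rintegral => y _.
  by rewrite partial1of2E; have := dfE a y => H; rewrite derive_val mulN1r.
have isin : mu.-integrable setT (EFin \o (fun y => sin (a * y + c) * (y * gauss_fun y))).
  apply: le_integrable iG => //.
    apply/measurable_EFinP; apply: measurable_funM.
      by apply: continuous_measurable_fun; exact: continuous_sin_affine.
    by apply: measurable_funM => //; exact: measurable_gauss_fun.
  move=> y _ /=; rewrite lee_fin; apply: le_trans (ler_norm _).
  have := fG a y Ia I; rewrite partial1of2E; have := dfE a y => H.
  by rewrite derive_val normrN.
by rewrite RintegralZl// mulN1r.
Qed.

(* Differentiating at [b = 0] the translation identity
   [int sin (a x + c) g (x - b) = int sin (a (x + b) + c) g x], where [g] is the
   Gaussian, yields this integration by parts without boundary terms. *)
Lemma Rintegral_sin_id_gauss (a c : R) :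
  \int[mu]_x (sin (a * x + c) * (x * gauss_fun x)) = a / 2 * gauss_cos a c.
Proof.
pose f (b x : R) := sin (a * x + c) * gauss_fun (x - b).
pose G (x : R) := 2 * expR 1 * expR (- (x ^+ 2) / 4).
have dfE (b x : R) : is_derive b 1 (f ^~ x)
    (sin (a * x + c) * (2 * (x - b) * gauss_fun (x - b))).
  have dsub : is_derive b 1 (fun b : R => x - b) (- 1).
    by apply: is_derive_eq; rewrite add0r mul1r.
  have := is_derive1_comp (f := gauss_fun) (g := fun b : R => x - b)
    (is_derive_gauss_fun (x - b)) dsub => H.
  have := @is_deriveZ _ _ _ _ (sin (a * x + c)) _ _ _ H.
  by move=> /is_derive_eq; apply; rewrite /GRing.scale/=; ring.
have I0 : `]-1, 1[%classic (0 : R) by rewrite /= in_itv/=; lra.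
have intf (x : R) : `]-1, 1[%classic x -> mu.-integrable setT (EFin \o f x).
  rewrite /= in_itv/= => x1; apply: integrable_bounded_gauss_shift => [//||y].
    by apply: continuous_measurable_fun; exact: continuous_sin_affine.
  exact: normr_sin_le1.
have derf (x y : R) : `]-1, 1[%classic x -> setT y -> derivable (f ^~ y) x 1.
  by move=> _ _; have [] := dfE x y.
have G0 y : 0 <= G y by rewrite !mulr_ge0 ?expR_ge0.
have iG : mu.-integrable setT (EFin \o G).
  exact: eq_integrable
    (integrableZl measurableT (2 * expR 1) integrable_expR_sqr_div4).
have fG (x y : R) : `]-1, 1[%classic x -> setT y -> `|partial1of2 f x y| <= G y.
  rewrite /= in_itv/= => x1 _; rewrite partial1of2E.
  have := dfE x y => H; rewrite derive_val normrM.
  have [le1 _] := gauss_fun_shift_bound y x1.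
  apply: le_trans le1; rewrite normrM (ger0_norm (gauss_fun_ge0 _)) normrM.
  rewrite (ger0_norm (ler0n _ 2)).
  have := normr_sin_le1 (a * y + c).
  have : 0 <= 2 * `|y - x| * gauss_fun (y - x) by rewrite !mulr_ge0 ?gauss_fun_ge0.
  have := normr_ge0 (sin (a * y + c)); nra.
pose A := gauss_cos a 0; pose B := \int[mu]_x (sin (a * x + 0) * gauss_fun x).
have iA : mu.-integrable setT (EFin \o (fun x => cos (a * x + 0) * gauss_fun x)).
  apply: integrable_bounded_gauss => [|y]; last exact: normr_cos_le1.
  by apply: continuous_measurable_fun; exact: continuous_cos_affine.
have iB : mu.-integrable setT (EFin \o (fun x => sin (a * x + 0) * gauss_fun x)).
  apply: integrable_bounded_gauss => [|y]; last exact: normr_sin_le1.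
  by apply: continuous_measurable_fun; exact: continuous_sin_affine.
have lin (p q : R) : \int[mu]_x (p * (cos (a * x + 0) * gauss_fun x) +
    q * (sin (a * x + 0) * gauss_fun x)) = p * A + q * B.
  rewrite RintegralD ?RintegralZl//.
    by apply: eq_integrable (integrableZl measurableT p iA).
  by apply: eq_integrable (integrableZl measurableT q iB).
have cosE : gauss_cos a c = cos c * A + (- sin c) * B.
  rewrite -lin; apply: eq_Rintegral => x _.
  by rewrite addr0 cosD; ring.
(* After the translation, [b] enters through the phase alone. The addition formulas then give an
   explicit function of [b] with constant coefficients [A] and [B], whose derivative at 0 is
   computed directly. *)
have KE (b : R) : -1 < b < 1 ->
    \int[mu]_x f b x = sin (a * b + c) * A + cos (a * b + c) * B.
  move=> b1; rewrite /f Rintegral_gauss_shift//; last 2 first.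
  - exact: continuous_sin_affine.
  - by move=> x; exact: normr_sin_le1.
  rewrite -lin; apply: eq_Rintegral => x _.
  by rewrite mulrDr -addrA sinD addr0; ring.
have dK := differentiation_under_integral measurableT I0 intf derf G0 iG fG.
have dK' : is_derive (0:R) 1 (fun b => sin (a * b + c) * A + cos (a * b + c) * B)
    (a * gauss_cos a c).
  have daff : is_derive (0:R) 1 (fun b : R => a * b + c) a.
    by apply: is_derive_eq; rewrite /GRing.scale/=; ring.
  have ds := is_derive1_comp (f := sin) (g := fun b : R => a * b + c)
    (is_derive_sin _) daff.
  have dc := is_derive1_comp (f := cos) (g := fun b : R => a * b + c)
    (is_derive_cos _) daff.
  have := is_deriveD (is_deriveM ds (is_derive_cst A (0:R) 1))
     (is_deriveM dc (is_derive_cst B (0:R) 1)).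
  by move=> /is_derive_eq; apply; rewrite cosE /GRing.scale/= (mulr0 a) add0r; ring.
have : (fun b => \int[mu]_x f b x)^`()%classic (0:R) = a * gauss_cos a c.
  (* [KE] is known for [|b| < 1] only; agreement near 0 determines the derivative there. *)
  rewrite derive1E -(@derive_val _ _ _ _ _ _ _ dK'); apply: near_eq_derive.
  apply/nbhs_ballP; exists 1 => //= b.
  by rewrite /ball/= sub0r normrN ltr_norml; exact: KE.
rewrite dK => H.
transitivity (2^-1 * (a * gauss_cos a c)); last by ring.
have ip : mu.-integrable setT (EFin \o (fun y => partial1of2 f 0 y)).
  apply: le_integrable iG => //.
    apply/measurable_EFinP.
    rewrite (_ : (fun y => partial1of2 f 0 y) =
        (fun x => sin (a * x + c) * (2 * (x - 0) * gauss_fun (x - 0)))); last first.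
      apply/funext => x; rewrite partial1of2E; have := dfE 0 x => ?.
      by rewrite derive_val.
    under eq_fun do rewrite subr0.
    apply: measurable_funM.
      by apply: continuous_measurable_fun; exact: continuous_sin_affine.
    apply: measurable_funM; last exact: measurable_gauss_fun.
    exact: measurable_funM.
  by move=> y _ /=; rewrite lee_fin; apply: le_trans (ler_norm _); exact: fG.
rewrite -H -RintegralZl//; apply: eq_Rintegral => y _.
rewrite partial1of2E; have := dfE 0 y => ?; rewrite derive_val subr0.
by field.
Qed.

(** The two preceding results give [f' = - (a / 2) f] for [f = gauss_cos ^~ c], so [exp (a^2 / 4) f]
    is constant. Its value at [a = 0] is [cos c] times the Gaussian integral [sqrt pi]. *)
Lemma Rintegral_gauss_cos (a c : R) :
  gauss_cos a c = expR (- a ^+ 2 / 4) * cos c * Num.sqrt pi.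
Proof.
pose W (a : R) := expR (a ^+ 2 / 4) * gauss_cos a c.
have dW (b : R) : is_derive b 1 W 0.
  have dsq : is_derive b 1 (fun b : R => b ^+ 2 / 4) (b / 2).
    by apply: is_derive_eq; rewrite /GRing.scale/=; field.
  have de := is_derive1_comp (f := expR) (g := fun b : R => b ^+ 2 / 4)
    (is_derive_expR _) dsq.
  have := is_deriveM de (derive_gauss_cos c b).
  by move=> /is_derive_eq; apply; rewrite Rintegral_sin_id_gauss /GRing.scale/=; field.
have := is_derive_0_is_cst a 0 dW.
rewrite /W expr0n/= mul0r expR0 mul1r => Wa.
have -> : gauss_cos a c = expR (- a ^+ 2 / 4) * (expR (a ^+ 2 / 4) * gauss_cos a c).
  by rewrite mulrA -expRD mulNr addNr expR0 mul1r.
rewrite Wa -mulrA; congr (_ * _).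
rewrite /gauss_cos; under eq_Rintegral do rewrite mul0r add0r.
rewrite RintegralZl//; last exact: integrableT_gauss.
by rewrite /Rintegral integralT_gauss.
Qed.

(* The range [0 <= q <= p] keeps the integrand nonnegative, so that Tonelli
   applies without integrability conditions; it is preserved when one
   coordinate is integrated out. *)
Lemma integral_cos_gauss (g a b c p q : R) : 0 < g -> 0 <= q -> q <= p ->
  (\int[mu]_x ((p + q * cos (a * x + c)) * expR (b * x - g * x ^+ 2))%:E =
   (Num.sqrt (pi / g) * expR (b ^+ 2 / (4 * g)) *
     (p + q * expR (- (a ^+ 2 / (4 * g))) * cos (c + a * b / (2 * g))))%:E)%E.
Proof.
(* The choice of [k] and [m] completes the square: [b x - g x^2 = b^2 / (4 g) - (k (x - m))^2]. *)
move=> g0 q0 qp; pose k := Num.sqrt g; pose m := b / (2 * g).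
have k0 : 0 < k by rewrite sqrtr_gt0.
have k2 : k ^+ 2 = g by rewrite sqr_sqrtr// ltW.
have gn0 : g != 0 by rewrite gt_eqF.
have kn0 : k != 0 by rewrite gt_eqF.
pose h (y : R) := p + q * cos (a / k * y + (c + a * m)).
have ch : continuous h.
  move=> y; apply: cvgD; first exact: cvg_cst.
  by apply: cvgM; [exact: cvg_cst|exact: continuous_cos_affine].
have h0 y : 0 <= h y.
  by have := cos_geN1 (a / k * y + (c + a * m)); rewrite /h; nra.
have IG : (\int[mu]_y (h y * gauss_fun y)%:E =
    (Num.sqrt pi * (p + q * expR (- (a ^+ 2 / (4 * g))) * cos (c + a * m)))%:E)%E.
  have i1 := @integrableT_gauss R.
  have i2 : mu.-integrable setT
      (EFin \o (fun y => cos (a / k * y + (c + a * m)) * gauss_fun y)).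
    apply: integrable_bounded_gauss => [|y]; last exact: normr_cos_le1.
    by apply: continuous_measurable_fun; exact: continuous_cos_affine.
  under eq_integral do
    rewrite /h mulrDl -mulrA EFinD !EFinM -[X in (X + _)%E]EFinM -EFinM.
  have j1 : mu.-integrable setT (fun y => (p%:E * (gauss_fun y)%:E)%E).
    exact: integrableZl.
  have j2 := integrableZl measurableT q i2.
  under eq_integral do rewrite EFinM.
  rewrite integralD//= integralZl//= integralZl//= integralT_gauss.
  have -> : (\int[mu]_x (cos (a / k * x + (c + a * m)) * gauss_fun x)%:E =
            (gauss_cos (a / k) (c + a * m))%:E)%E.
    by rewrite /gauss_cos /Rintegral fineK//; exact: (integrable_fin_num measurableT i2).
  rewrite Rintegral_gauss_cos -!EFinM -EFinD; congr EFin.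
  rewrite expr_div_n k2 (_ : - (a ^+ 2 / g) / 4 = - (a ^+ 2 / (4 * g))); last by field.
  by ring.
have := @ge0_integral_affine (fun y => h y * gauss_fun y) k m k0 _ _.
rewrite IG => /(_ _ _)/esym H.
have IE : (\int[mu]_x (h (k * (x - m))%R * gauss_fun (k * (x - m))%R)%:E =
    (expR (- (b ^+ 2 / (4 * g))))%:E *
    \int[mu]_x ((p + q * cos (a * x + c)) * expR (b * x - g * x ^+ 2))%:E)%E.
  rewrite -ge0_integralZl//.
  - apply: eq_integral => x _; rewrite -EFinM; congr EFin.
    rewrite mulrCA; congr (_ * _).
      rewrite /h; congr (p + q * cos _); rewrite mulrA divfK//; ring.
    rewrite -expRD /gauss_fun; congr expR; rewrite exprMn k2 /m; field.
    by [].
  - apply/measurable_EFinP; apply: measurable_funM.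
      apply: continuous_measurable_fun => x; apply: cvgD; first exact: cvg_cst.
      by apply: cvgM; [exact: cvg_cst|exact: continuous_cos_affine].
    apply: measurableT_comp => //; apply: measurable_funB; exact: measurable_funM.
  - move=> x _; rewrite lee_fin mulr_ge0 ?expR_ge0//.
    by have := cos_geN1 (a * x + c); nra.
have {H} : (k%:E * ((expR (- (b ^+ 2 / (4 * g))))%:E *
    \int[mu]_x ((p + q * cos (a * x + c)) * expR (b * x - g * x ^+ 2))%:E) =
    (Num.sqrt pi * (p + q * expR (- (a ^+ 2 / (4 * g))) * cos (c + a * m)))%:E)%E.
  rewrite -IE; apply: H => y.
    by apply: cvgM; [exact: ch|exact: continuous_gauss_fun].
  by rewrite mulr_ge0 ?gauss_fun_ge0.
set I := integral _ _ _ => H.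
(* [I] is an extended real not yet known to be finite, so the constants are removed by multiplying
   by their inverses. *)
have -> : I = ((expR (b ^+ 2 / (4 * g)) / k)%:E *
    (k%:E * ((expR (- (b ^+ 2 / (4 * g))))%:E * I)))%E.
  rewrite !muleA -!EFinM divfK// -expRD subrr expR0 mul1e//.
rewrite H -EFinM sqrtrM ?pi_ge0// sqrtrV ?(ltW g0)// -/k; congr EFin.
by rewrite /m mulrA; ring.
Qed.

End gauss_characteristic_function.

(** * Gaussian integrals over R^d *)

Section lebesgue_tuple_theory.
Context {R : realType}.
Local Notation mu := (@lebesgue_measure R).

Lemma lebesgue_tuple_sigma_finite d : sigma_finite setT (@lebesgue_tuple R d).
Proof.
pose A (k : nat) (i : 'I_d) : set R := `[- k%:R, k%:R]%classic.
exists (fun k => [set t : d.-tuple R | forall i, A k i (tnth t i)]).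
  apply/esym; rewrite -subTset => t _.
  pose M := \sum_(i < d) `|tnth t i|.
  exists (Num.truncn M).+1 => // i; rewrite /A/= in_itv/= -ler_norml ltW//.
  have M0 : 0 <= M by exact: sumr_ge0.
  apply: le_lt_trans (truncnS_gt M).
  by rewrite /M (bigD1 i)//= lerDl sumr_ge0.
move=> k; split.
  rewrite (_ : mkset _ = \bigcap_(i in setT) ((@tnth d R ^~ i) @^-1` A k i)).
    apply: fin_bigcap_measurable => [|i _]; first exact: finite_finset.
    rewrite -[X in measurable X]setTI; apply: measurable_tnth => //.
    exact: measurable_itv.
  by apply/seteqP; split=> t /= At i; [move=> _|]; exact: At.
rewrite lebesgue_tuple_box; last by move=> i; exact: measurable_itv.
rewrite ltey_eq; apply/orP; left.
apply: (big_ind (fun x : \bar R => x \is a fin_num)) => [//|x y|i _].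
  exact: fin_numM.
by rewrite /A lebesgue_measure_itv/=; case: ifP.
Qed.

(** The fixpoint [lebesgue_tuple] is typed as a plain measure; this repackages the same measure with
    the structure under which Tonelli is applied. *)
Definition sigma_finite_lebesgue_tuple d :
    {sigma_finite_measure set (d.-tuple R) -> \bar R} :=
  HB.pack_for (SigmaFiniteMeasure.type (d.-tuple R) R)
    (Measure.sort (@lebesgue_tuple R d))
    (isSFinite.Build _ _ _ _
      (sfinite_measure_sigma_finite (lebesgue_tuple_sigma_finite d)))
    (isSigmaFinite.Build _ _ _ _ (lebesgue_tuple_sigma_finite d)).

Lemma ge0_integral_lebesgue_tupleS d (f : d.+1.-tuple R -> \bar R) :
  measurable_fun setT f -> (forall t, 0 <= f t)%E ->
  (\int[lebesgue_tuple d.+1]_t f t =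
   \int[lebesgue_tuple d]_t \int[mu]_x f (tuple_cons (t, x)))%E.
Proof.
move=> mf f0.
rewrite [LHS](ge0_integral_pushforward (@measurable_tuple_cons R d))//.
rewrite preimage_setT.
rewrite (@fubini_tonelli1 _ _ _ _ _ (sigma_finite_lebesgue_tuple d) mu)//.
  exact: measurableT_comp mf (@measurable_tuple_cons R d).
by move=> z; exact: f0.
Qed.

Definition ldot d (a : 'I_d -> R) (t : d.-tuple R) := \sum_(i < d) a i * tnth t i.

Definition sqnorm d (t : d.-tuple R) := \sum_(i < d) tnth t i ^+ 2.

Lemma ldot_cons d (a : 'I_d.+1 -> R) (t : d.-tuple R) (x : R) :
  ldot a (tuple_cons (t, x)) = a ord0 * x + ldot (fun i => a (lift ord0 i)) t.
Proof.
rewrite /ldot big_ord_recl tnth0; congr (_ + _).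
by apply: eq_bigr => i _; rewrite tnthS.
Qed.

Lemma sqnorm_cons d (t : d.-tuple R) (x : R) :
  sqnorm (tuple_cons (t, x)) = x ^+ 2 + sqnorm t.
Proof.
rewrite /sqnorm big_ord_recl tnth0; congr (_ + _).
by apply: eq_bigr => i _; rewrite tnthS.
Qed.

Lemma measurable_ldot d (a : 'I_d -> R) : measurable_fun setT (ldot a).
Proof.
apply: measurable_sum => i; apply: measurable_funM => //; exact: measurable_tnth.
Qed.

Lemma measurable_sqnorm d : measurable_fun setT (@sqnorm d).
Proof.
apply: measurable_sum => i; apply: measurable_funX; exact: measurable_tnth.
Qed.

(** The weight [exp (- g |t|^2)] times the factor [exp (b . t)] of the empirical moment generating
    function; [b = 0] gives the weight alone. *)
Definition gauss_kernel g d (b : 'I_d -> R) (t : d.-tuple R) :=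
  expR (ldot b t - g * sqnorm t).

Lemma measurable_gauss_kernel g d (b : 'I_d -> R) :
  measurable_fun setT (gauss_kernel g b).
Proof.
apply: measurableT_comp => //; apply: measurable_funB; first exact: measurable_ldot.
by apply: measurable_funM => //; exact: measurable_sqnorm.
Qed.

Lemma measurable_cos_ldot d (a : 'I_d -> R) (c : R) :
  measurable_fun setT (fun t => cos (ldot a t + c)).
Proof.
apply: measurableT_comp.
  by apply: continuous_measurable_fun; exact: continuous_cos.
by apply: measurable_funD => //; exact: measurable_ldot.
Qed.

(** Integrating out one coordinate reproduces the form [p + q cos]: [q] is damped by
    [exp (- a_0^2 / (4 g))] and the phase moves by [a_0 b_0 / (2 g)]. The induction is therefore on
    [d] with [c] and [q] arbitrary. *)
Lemma integral_lebesgue_tuple_cos (g : R) d (a b : 'I_d -> R) (c p q : R) :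
  0 < g -> 0 <= q -> q <= p ->
  (\int[lebesgue_tuple d]_t ((p + q * cos (ldot a t + c)) * gauss_kernel g b t)%:E =
   (Num.sqrt (pi / g) ^+ d * expR ((\sum_i b i ^+ 2) / (4 * g)) *
     (p + q * expR (- ((\sum_i a i ^+ 2) / (4 * g))) *
      cos (c + (\sum_i a i * b i) / (2 * g))))%:E)%E.
Proof.
move=> g0.
have mF n (a' b' : 'I_n -> R) c' q' :
    measurable_fun setT
      (fun t => ((p + q' * cos (ldot a' t + c')) * gauss_kernel g b' t)%:E).
  apply/measurable_EFinP; apply: measurable_funM; last exact: measurable_gauss_kernel.
  apply: measurable_funD => //; apply: measurable_funM => //.
  exact: measurable_cos_ldot.
elim: d a b c q => [|d IH] a b c q q0 qp.
  rewrite /= integral_dirac//; last exact: mF.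
  rewrite diracE mem_set// mul1e /gauss_kernel /ldot /sqnorm !big_ord0.
  by rewrite !mul0r mulr0 subrr oppr0 expR0 expr0 !mulr1 mul1r addr0 add0r.
have F0 n (a' b' : 'I_n -> R) c' q' t : 0 <= q' -> q' <= p ->
    0 <= (p + q' * cos (ldot a' t + c')) * gauss_kernel g b' t.
  move=> q'0 q'p; rewrite mulr_ge0 ?expR_ge0//.
  by have := cos_geN1 (ldot a' t + c'); nra.
rewrite ge0_integral_lebesgue_tupleS//; last first.
  by move=> t; rewrite lee_fin F0.
pose a' i := a (lift ord0 i); pose b' i := b (lift ord0 i).
pose K := Num.sqrt (pi / g) * expR (b ord0 ^+ 2 / (4 * g)).
pose q' := q * expR (- (a ord0 ^+ 2 / (4 * g))).
pose c' := c + a ord0 * b ord0 / (2 * g).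
have q'0 : 0 <= q' by rewrite mulr_ge0 ?expR_ge0.
have q'p : q' <= p.
  apply: le_trans qp; rewrite ler_piMr// -expR0 ler_expR oppr_le0.
  by rewrite divr_ge0 ?sqr_ge0// mulr_ge0 ?ltW.
transitivity (\int[lebesgue_tuple d]_t
    (K%:E * ((p + q' * cos (ldot a' t + c')) * gauss_kernel g b' t)%:E))%E.
  apply: eq_integral => t _.
  transitivity (\int[mu]_x ((gauss_kernel g b' t)%:E *
      ((p + q * cos (a ord0 * x + (ldot a' t + c))) *
        expR (b ord0 * x - g * x ^+ 2))%:E))%E.
    apply: eq_integral => x _; rewrite -EFinM; congr EFin.
    rewrite ldot_cons -addrA mulrCA; congr (_ * _).
    rewrite /gauss_kernel -expRD; congr expR; rewrite ldot_cons sqnorm_cons.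
    by rewrite /b'; ring.
  rewrite ge0_integralZl//=; first last.
  - by rewrite lee_fin expR_ge0.
  - move=> x _; rewrite lee_fin mulr_ge0 ?expR_ge0//.
    by have := cos_geN1 (a ord0 * x + (ldot a' t + c)); nra.
  - apply/measurable_EFinP; apply: measurable_funM.
      apply: continuous_measurable_fun => x; apply: cvgD; first exact: cvg_cst.
      by apply: cvgM; [exact: cvg_cst|exact: continuous_cos_affine].
    by apply: measurableT_comp => //; apply: measurable_funB; exact: measurable_funM.
  rewrite integral_cos_gauss// -!EFinM; congr EFin.
  by rewrite /K /q' /c' addrA; ring.
rewrite ge0_integralZl//=; first last.
- by rewrite lee_fin mulr_ge0 ?expR_ge0// sqrtr_ge0.
- by move=> t _; rewrite lee_fin F0.
- exact: mF.
rewrite IH// -EFinM !big_ord_recl; congr EFin.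
rewrite /K /q' /c' !(mulrDl _ _ (4 * g)^-1) (mulrDl _ _ (2 * g)^-1) opprD !expRD.
by rewrite (exprS (Num.sqrt _)) (addrA c) [in RHS](mulrA q) [in RHS]mulrACA -[RHS]mulrA.
Qed.

End lebesgue_tuple_theory.

Section gauss_tuple_cos.
Context {R : realType} (g : R) (d : nat).
Hypothesis g0 : 0 < g.
Local Notation mu := (@lebesgue_tuple R d).

Let integrable1 (a b : 'I_d -> R) (q : R) : 0 <= q <= 1 ->
  mu.-integrable setT
    (EFin \o (fun t => (1 + q * cos (ldot a t + 0)) * gauss_kernel g b t)).
Proof.
move=> /andP[q0 q1]; apply/integrableP; split.
  apply/measurable_EFinP; apply: measurable_funM; last exact: measurable_gauss_kernel.
  apply: measurable_funD => //; apply: measurable_funM => //.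
  exact: measurable_cos_ldot.
under eq_integral => t _.
  rewrite gee0_abs; last first.
    rewrite lee_fin mulr_ge0 ?expR_ge0//.
    by have := cos_geN1 (ldot a t + 0); nra.
  over.
by rewrite (integral_lebesgue_tuple_cos a b 0 g0 q0 q1) ltry.
Qed.

Let Rintegral1 (a b : 'I_d -> R) (q : R) : 0 <= q <= 1 ->
  \int[mu]_t ((1 + q * cos (ldot a t + 0)) * gauss_kernel g b t) =
  Num.sqrt (pi / g) ^+ d * expR ((\sum_i b i ^+ 2) / (4 * g)) *
     (1 + q * expR (- ((\sum_i a i ^+ 2) / (4 * g))) *
      cos (0 + (\sum_i a i * b i) / (2 * g))).
Proof.
by move=> /andP[q0 q1]; rewrite /Rintegral (integral_lebesgue_tuple_cos a b 0 g0 q0 q1).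
Qed.

(** The signed integrand as a difference of the nonnegative cases [q = 1] and [q = 0] of the formula
    above. *)
Let cos_kernelE (a b : 'I_d -> R) :
  (fun t => cos (ldot a t) * gauss_kernel g b t) =
  (fun t => (1 + 1 * cos (ldot a t + 0)) * gauss_kernel g b t -
            (1 + 0 * cos (ldot a t + 0)) * gauss_kernel g b t).
Proof. by apply/funext => t; rewrite addr0; ring. Qed.

Lemma integrable_cos_gauss_kernel (a b : 'I_d -> R) :
  mu.-integrable setT (EFin \o (fun t => cos (ldot a t) * gauss_kernel g b t)).
Proof.
rewrite cos_kernelE; apply: (@integrableB _ _ _ mu setT measurableT
  (EFin \o (fun t => (1 + 1 * cos (ldot a t + 0)) * gauss_kernel g b t))
  (EFin \o (fun t => (1 + 0 * cos (ldot a t + 0)) * gauss_kernel g b t))).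
  by apply: integrable1; rewrite ler01 lexx.
by apply: integrable1; rewrite ler01 lexx.
Qed.

Lemma Rintegral_cos_gauss_kernel (a b : 'I_d -> R) :
  \int[mu]_t (cos (ldot a t) * gauss_kernel g b t) =
  Num.sqrt (pi / g) ^+ d *
    (expR ((\sum_i b i ^+ 2 - \sum_i a i ^+ 2) / (4 * g)) *
     cos ((\sum_i a i * b i) / (2 * g))).
Proof.
rewrite cos_kernelE RintegralB//; last 2 first.
- by apply: integrable1; rewrite ler01 lexx.
- by apply: integrable1; rewrite ler01 lexx.
rewrite !Rintegral1 ?ler01 ?lexx//.
rewrite (mulrBl (4 * g)^-1) expRD add0r; ring.
Qed.

End gauss_tuple_cos.

Lemma Rintegral_sum d (T : measurableType d) (R : realType)
    (mu : {measure set T -> \bar R}) (I : Type) (s : seq I) (f : I -> T -> R) :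
  (forall i, mu.-integrable setT (EFin \o f i)) ->
  \int[mu]_x (\sum_(i <- s) f i x) = \sum_(i <- s) \int[mu]_x f i x.
Proof.
move=> intf; elim: s => [|i s IH].
  rewrite big_nil; under eq_Rintegral do rewrite big_nil.
  by rewrite Rintegral_cst// mul0r.
rewrite big_cons -IH -RintegralD//; first by apply: eq_Rintegral => x _; rewrite big_cons.
apply: eq_integrable
  (integrable_sum measurableT s (P := xpredT) (fun i _ => intf i)) => //.
by move=> x _; rewrite /= -sumEFin.
Qed.

(** * Closed form of the statistic as a double sum over the residuals *)

Section T_stat_closed_form.
Context {R : realType} (d n : nat) (x : 'I_n -> 'cV[R]_d) (g : R).
Hypothesis g0 : 0 < g.
Local Notation Y := (scaled_residual x).

Lemma dotv_vec_of_tuple (u : 'cV[R]_d) t :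
  dotv (vec_of_tuple t) u = ldot (fun i => u i 0) t.
Proof. by rewrite /dotv mxE; apply: eq_bigr => i _; rewrite !mxE mulrC. Qed.

Lemma dotvE (u v : 'cV[R]_d) : dotv u v = \sum_i u i 0 * v i 0.
Proof. by rewrite /dotv mxE; apply: eq_bigr => i _; rewrite !mxE. Qed.

Lemma gauss_weight_vec_of_tuple t :
  gauss_weight g (vec_of_tuple t) = gauss_kernel g (fun _ : 'I_d => 0) t :> R.
Proof.
rewrite /gauss_weight /gauss_kernel enorm_sqr dotvE /ldot.
rewrite [X in X - _]big1 ?sub0r => [|i _]; last by rewrite mul0r.
by rewrite mulNr; congr (expR (- (_ * _))); apply: eq_bigr => i _; rewrite !mxE expr2.
Qed.

Lemma T_statE :
  T_stat x g = Num.sqrt n%:R * Num.sqrt (pi / g) ^+ d *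
    (n%:R ^- 2 * (\sum_j \sum_k
       expR ((dotv (Y k) (Y k) - dotv (Y j) (Y j)) / (4 * g)) *
       cos (dotv (Y j) (Y k) / (2 * g))) - 1).
Proof.
pose y j i := Y j i 0.
pose F t := \sum_j \sum_k cos (ldot (y j) t) * gauss_kernel g (y k) t.
(* The weight, written with zero vectors so that the term [- 1] of [U_stat] is integrated by the
   same formula as the others. *)
pose G (t : d.-tuple R) := cos (ldot (fun=> 0) t) * gauss_kernel g (fun=> 0) t.
have iF j : (lebesgue_tuple d).-integrable setT
    (EFin \o (fun t => \sum_k cos (ldot (y j) t) * gauss_kernel g (y k) t)).
  apply: eq_integrable (integrable_sum measurableT (index_enum _) (P := xpredT)
    (fun k _ => integrable_cos_gauss_kernel g0 (y j) (y k))) => //.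
  by move=> t _; rewrite /= -sumEFin.
have iFF : (lebesgue_tuple d).-integrable setT (EFin \o F).
  apply: eq_integrable (integrable_sum measurableT (index_enum _) (P := xpredT)
    (fun j _ => iF j)) => //.
  by move=> t _; rewrite /= -sumEFin.
have iG : (lebesgue_tuple d).-integrable setT (EFin \o G).
  exact: integrable_cos_gauss_kernel.
have GE : \int[lebesgue_tuple d]_t G t = Num.sqrt (pi / g) ^+ d.
  rewrite /G Rintegral_cos_gauss_kernel// subrr mul0r expR0 mul1r.
  by rewrite big1 ?mul0r ?cos0 ?mulr1// => i _; rewrite mul0r.
have iF' : (lebesgue_tuple d).-integrable setT (EFin \o (fun t => n%:R ^- 2 * F t)).
  exact: (integrableZl measurableT (n%:R ^- 2) iFF).
have -> : T_stat x g =
    \int[lebesgue_tuple d]_t (Num.sqrt n%:R * (n%:R ^- 2 * F t - G t)).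
  apply: eq_Rintegral => t _; rewrite /U_stat -mulrA; congr (_ * _).
  rewrite gauss_weight_vec_of_tuple mulrBl; congr (_ - _); last first.
    by rewrite /G /ldot big1 ?cos0// => i _; rewrite mul0r.
  rewrite /empirical_cos /empirical_mgf mulrACA -invfM -expr2 -mulrA; congr (_ * _).
  rewrite mulr_suml mulr_suml; apply: eq_bigr => j _.
  rewrite mulr_sumr mulr_suml; apply: eq_bigr => k _.
  rewrite !dotv_vec_of_tuple -mulrA; congr (_ * _).
  rewrite /gauss_kernel -expRD; congr expR.
  by rewrite [X in _ + (X - _)]big1 ?sub0r// => i _; rewrite mul0r.
rewrite RintegralZl//; last first.
  exact: (@integrableB _ _ _ (lebesgue_tuple d) setT measurableT
    (EFin \o (fun t => n%:R ^- 2 * F t)) (EFin \o G)).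
rewrite -mulrA; congr (_ * _).
rewrite RintegralB// RintegralZl// Rintegral_sum//.
under eq_bigr => j _.
  rewrite Rintegral_sum; last by move=> k; exact: integrable_cos_gauss_kernel.
  under eq_bigr do rewrite Rintegral_cos_gauss_kernel//.
  rewrite -mulr_sumr.
  over.
rewrite -mulr_sumr GE.
rewrite mulrBr mulr1 mulrCA; congr (_ * _ - _).
congr (_ * _); apply: eq_bigr => j _; apply: eq_bigr => k _.
by rewrite !dotvE.
Qed.

End T_stat_closed_form.

(** * The limit of the statistic *)

Section second_order.
Context {R : realType}.
Variables u w : R.
(** [E] and [H] are the real and imaginary parts of [exp ((u + i w) s)], so their derivatives are
    linear combinations of the two. *)
Let E (s : R) := expR (u * s) * cos (w * s).
Let H (s : R) := expR (u * s) * sin (w * s).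

Let dE (s : R) : is_derive s 1 E (u * E s - w * H s).
Proof.
have du : is_derive s 1 (fun s : R => u * s) u.
  by apply: is_derive_eq; rewrite /GRing.scale/= mulr1.
have dw : is_derive s 1 (fun s : R => w * s) w.
  by apply: is_derive_eq; rewrite /GRing.scale/= mulr1.
have := is_deriveM
  (is_derive1_comp (f := expR) (g := fun s => u * s) (is_derive_expR _) du)
  (is_derive1_comp (f := cos) (g := fun s => w * s) (is_derive_cos _) dw).
by move=> /is_derive_eq; apply; rewrite /GRing.scale/= /E /H; ring.
Qed.

Let dH (s : R) : is_derive s 1 H (u * H s + w * E s).
Proof.
have du : is_derive s 1 (fun s : R => u * s) u.
  by apply: is_derive_eq; rewrite /GRing.scale/= mulr1.
have dw : is_derive s 1 (fun s : R => w * s) w.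
  by apply: is_derive_eq; rewrite /GRing.scale/= mulr1.
have := is_deriveM
  (is_derive1_comp (f := expR) (g := fun s => u * s) (is_derive_expR _) du)
  (is_derive1_comp (f := sin) (g := fun s => w * s) (is_derive_sin _) dw).
by move=> /is_derive_eq; apply; rewrite /GRing.scale/= /E /H; ring.
Qed.

Let E0 : E 0 = 1. Proof. by rewrite /E !mulr0 expR0 cos0 mulr1. Qed.
Let H0 : H 0 = 0. Proof. by rewrite /H !mulr0 sin0 mulr0. Qed.

Let cE : E x @[x --> (0:R)^'+] --> (1:R).
Proof.
rewrite -E0; apply: cvg_at_right_filter.
by apply/differentiable_continuous/derivable1_diffP; have [] := dE 0.
Qed.

Let cH : H x @[x --> (0:R)^'+] --> (0:R).
Proof.
rewrite -[X in _ --> X]H0; apply: cvg_at_right_filter.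
by apply/differentiable_continuous/derivable1_diffP; have [] := dH 0.
Qed.

Let cid : x @[x --> (0:R)^'+] --> (0:R).
Proof. by apply: cvg_at_right_filter; exact: cvg_id. Qed.

(** The limit is the second Taylor coefficient of [Re (exp ((u + i w) s))], namely
    [Re ((u + i w)^2) / 2]; two applications of l'Hopital's rule reach it. *)
Lemma expR_cos_second_order :
  (expR (u * s) * cos (w * s) - 1 - u * s) / s ^+ 2 @[s --> (0:R)^'+]
    --> (u ^+ 2 - w ^+ 2) / 2.
Proof.
apply: (@lhopital_at_right R (fun s => E s - 1 - u * s)
  (fun s => u * E s - w * H s - u) (fun s => s ^+ 2) (fun s => 2 * s) 0 1).
- exact: ltr01.
- move=> s _; have := dE s => ?; apply: is_derive_eq.
  by rewrite /GRing.scale/= subr0 mulr1.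
- move=> s _; apply: is_derive_eq.
  by rewrite /GRing.scale/=; ring.
- rewrite [X in _ --> X](_ : _ = 1 - 1 - u * 0); last by ring.
  apply: cvgB; first by apply: cvgB; [exact: cE|exact: cvg_cst].
  by apply: cvgM; [exact: cvg_cst|exact: cid].
- rewrite [X in _ --> X](_ : _ = 0 * 0); last by rewrite mulr0.
  by under eq_fun do rewrite expr2; apply: cvgM; exact: cid.
- by move=> s; rewrite in_itv/= => /andP[s0 _]; rewrite mulf_neq0// gt_eqF.
apply: (@lhopital_at_right R _
  (fun s => u * (u * E s - w * H s) - w * (u * H s + w * E s)) _ (fun=> 2) 0 1).
- exact: ltr01.
- move=> s _; have := dE s => ?; have := dH s => ?; apply: is_derive_eq.
  by rewrite /GRing.scale/= subr0.
- by move=> s _; apply: is_derive_eq; rewrite /GRing.scale/= mulr1.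
- rewrite [X in _ --> X](_ : _ = u * 1 - w * 0 - u); last by ring.
  apply: cvgB; last exact: cvg_cst.
  by apply: cvgB; apply: cvgM => //; exact: cvg_cst.
- rewrite [X in _ --> X](_ : _ = 2 * 0); last by rewrite mulr0.
  by apply: cvgM; [exact: cvg_cst|exact: cid].
- by move=> s _.
apply: cvgM; last exact: cvg_cst.
rewrite [X in _ --> X](_ : _ = u * (u * 1 - w * 0) - w * (u * 0 + w * 1)); last by ring.
apply: cvgB; apply: cvgM; (try exact: cvg_cst).
  by apply: cvgB; apply: cvgM => //; exact: cvg_cst.
by apply: cvgD; apply: cvgM => //; exact: cvg_cst.
Qed.

End second_order.

Lemma cvg_inv4_pinfty (R : realType) : (4 * g)^-1 @[g --> +oo] --> (0 : R)^'+.
Proof.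
move=> P [e /= e0 Pe]; change (\forall g \near +oo, P (4 * g)^-1); near=> g.
have g0 : 0 < g by near: g; apply: nbhs_pinfty_gt; rewrite num_real.
have ge : e^-1 < g by near: g; apply: nbhs_pinfty_gt; rewrite num_real.
apply: Pe => /=; last by rewrite invr_gt0 mulr_gt0.
rewrite sub0r normrN gtr0_norm ?invr_gt0 ?mulr_gt0// invf_plt ?posrE ?mulr_gt0//.
lra.
Unshelve. all: by end_near. Qed.

Section limit.
Context {R : realType} (d n : nat) (x : 'I_n -> 'cV[R]_d).
Hypothesis n0 : (0 < n)%N.
Hypothesis Su : sample_cov x \in unitmx.
Local Notation Y := (scaled_residual x).
Let u j k := dotv (Y k) (Y k) - dotv (Y j) (Y j).
Let w j k := 2 * dotv (Y j) (Y k).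
Let nn0 : n%:R != 0 :> R. Proof. by rewrite pnatr_eq0 -lt0n. Qed.

Let sum_u : \sum_j \sum_k u j k = 0.
Proof.
under eq_bigr do rewrite big_split/=.
rewrite big_split/= exchange_big -big_split/=; apply: big1 => j _.
by rewrite -big_split/=; apply: big1 => k _; rewrite subrr.
Qed.

(** With [s = (4 g)^-1], the factor [16 g^2] is [s^-2], and the powers of [pi] cancel. The terms
    [u j k * s] are inserted at no cost because they sum to zero; each summand then has its own
    limit. *)
Lemma rescaled_T_statE (g : R) : 0 < g ->
  g `^ (2 + d%:R / 2) * (16 * T_stat x g / (Num.sqrt n%:R * pi `^ (d%:R / 2))) =
  n%:R ^- 2 * \sum_j \sum_k
    (expR (u j k * (4 * g)^-1) * cos (w j k * (4 * g)^-1) - 1 -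
     u j k * (4 * g)^-1) / ((4 * g)^-1) ^+ 2.
Proof.
move=> g0; have gn0 : g != 0 by rewrite gt_eqF.
have sn0 : Num.sqrt n%:R != 0 :> R by rewrite sqrtr_eq0 -ltNge ltr0n.
have p0 : pi `^ (d%:R / 2) != 0 :> R by rewrite gt_eqF// powR_gt0// pi_gt0.
have Sd : g `^ (2 + d%:R / 2) * Num.sqrt (pi / g) ^+ d = g ^+ 2 * pi `^ (d%:R / 2).
  rewrite powRD; last by rewrite gn0 implybT.
  rewrite powR_mulrn ?ltW// -mulrA; congr (_ * _).
  rewrite -powR12_sqrt ?divr_ge0 ?pi_ge0 ?ltW// -powR_mulrn ?powR_ge0// -powRrM.
  rewrite (mulrC _^-1) -powRM ?divr_ge0 ?pi_ge0 ?ltW//.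
  by rewrite mulrCA divff// mulr1.
rewrite T_statE//; set Z := \sum_j \sum_k _.
transitivity (16 * g ^+ 2 * (n%:R ^- 2 * Z - 1)).
  have aux (A B C s W G : R) : s != 0 -> B != 0 -> A * C = G * B ->
      A * (16 * (s * C * W) / (s * B)) = 16 * G * W.
    move=> s0 B0 ACE; transitivity (16 * W * (A * C) / B); first by field; apply/andP.
    by rewrite ACE; field.
  exact: aux.
transitivity (16 * g ^+ 2 * (n%:R ^- 2 * (Z - n%:R ^+ 2))).
  by congr (_ * _); rewrite mulrBr mulVf// expf_neq0.
rewrite mulrCA; congr (_ * _).
transitivity (16 * g ^+ 2 * \sum_j \sum_k
    (expR (u j k * (4 * g)^-1) * cos (w j k * (4 * g)^-1) - 1 -
     u j k * (4 * g)^-1)).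
  congr (_ * _).
  transitivity (Z - \sum_(j < n) \sum_(k < n) 1 - (\sum_j \sum_k u j k) * (4 * g)^-1).
    rewrite sum_u mul0r subr0; congr (_ - _).
    by rewrite !sumr_const !card_ord -mulrnA mulnn natrX.
  rewrite mulr_suml -!sumrB; apply: eq_bigr => j _.
  rewrite mulr_suml -!sumrB; apply: eq_bigr => k _.
  congr (_ * cos _ - _ - _); rewrite /w.
  by field.
rewrite mulr_sumr; apply: eq_bigr => j _; rewrite mulr_sumr; apply: eq_bigr => k _.
by field.
Qed.

Lemma cvg_rescaled_T_stat :
  (g `^ (2 + d%:R / 2) * (16 * T_stat x g / (Num.sqrt n%:R * pi `^ (d%:R / 2))))
      @[g --> +oo]
    --> mardia_kurtosis x - d%:R * (d%:R + 2).
Proof.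
have -> : mardia_kurtosis x - d%:R * (d%:R + 2) =
    n%:R ^- 2 * \sum_j \sum_k (u j k ^+ 2 - w j k ^+ 2) / 2.
  pose b := \sum_j dotv (Y j) (Y j) ^+ 2.
  have -> : mardia_kurtosis x = n%:R^-1 * b.
    congr (_ * _); apply: eq_bigr => j _.
    by rewrite -[4%N]/(2 * 2)%N exprM enorm_sqr.
  have S1 := sum_sqr_residual n0 Su.
  have S2 := sum_sqr_dotv_residual n0 Su.
  (* Expanding the squares: half the sum of [u^2] is [n \sum_j |Y j|^4 - (\sum_j |Y j|^2)^2], and
     half the sum of [w^2] is twice the sum of [(Y j . Y k)^2]. The whitening identities evaluate
     both, which produces [d^2] and [2 d]. *)
  have -> : \sum_j \sum_k (u j k ^+ 2 - w j k ^+ 2) / 2 =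
      n%:R * b - (n%:R * d%:R) ^+ 2 - 2 * (n%:R ^+ 2 * d%:R).
    rewrite -S1 -S2.
    transitivity (\sum_j \sum_k (2^-1 * dotv (Y k) (Y k) ^+ 2
      + 2^-1 * dotv (Y j) (Y j) ^+ 2
      - dotv (Y j) (Y j) * dotv (Y k) (Y k) - 2 * dotv (Y j) (Y k) ^+ 2)).
      by apply: eq_bigr => j _; apply: eq_bigr => k _; rewrite /u /w; field.
    under eq_bigr do rewrite !sumrB big_split/= -!mulr_sumr sumr_const card_ord -/b.
    rewrite !sumrB big_split/= sumr_const card_ord -mulr_suml -!mulr_sumr.
    have -> : \sum_j dotv (Y j) (Y j) * (dotv (Y j) (Y j) *+ n) = b *+ n.
      by rewrite -sumrMnl; apply: eq_bigr => j _; rewrite mulrnAr expr2.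
    have half (p : R) m : 2^-1 * p *+ m + 2^-1 * (p *+ m) = m%:R * p.
      by rewrite -(mulr_natr p) -(mulr_natr (2^-1 * p)); field.
    by rewrite half expr2.
  by field.
apply: (@cvg_trans _ ((n%:R ^- 2 * \sum_j \sum_k
    (expR (u j k * (4 * g)^-1) * cos (w j k * (4 * g)^-1) - 1 -
     u j k * (4 * g)^-1) / ((4 * g)^-1) ^+ 2) @[g --> +oo])).
  apply: near_eq_cvg; near=> g.
  have g0 : 0 < g by near: g; apply: nbhs_pinfty_gt; rewrite num_real.
  by rewrite rescaled_T_statE.
apply: cvgM; first exact: cvg_cst.
apply: cvg_big => [|j _]; first exact: add_continuous.
apply: cvg_big => [|k _]; first exact: add_continuous.
exact: (cvg_comp _ _ (@cvg_inv4_pinfty R) (@expR_cos_second_order R (u j k) (w j k))).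
Unshelve. all: by end_near. Qed.

End limit.

(** * Almost sure invertibility *)

Lemma measurable_hyperplane (R : realType) d (a : 'I_d -> R) (c : R) :
  measurable [set t : d.-tuple R | ldot a t + c = 0].
Proof.
have mf : measurable_fun setT (fun t => ldot a t + c).
  by apply: measurable_funD => //; exact: measurable_ldot.
have := mf measurableT [set 0] (measurable_set1 0).
by rewrite setTI.
Qed.

(** If the first coefficient is zero, the set is a cylinder over a set of the same kind in one
    dimension less; otherwise each line along the first coordinate meets it in one point. The case
    [a = 0], [c != 0] is the empty set, and it does occur, since [(c, a)] will be an arbitrary
    nonzero kernel vector. *)
Lemma null_hyperplane (R : realType) d (a : 'I_d -> R) (c : R) :
  (c != 0) || [exists i, a i != 0] ->
  lebesgue_tuple d [set t | ldot a t + c = 0] = 0%E.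
Proof.
elim: d a c => [|d IH] a c.
  case/orP => [c0|/existsP[[]]//].
  rewrite (_ : [set _ | _] = set0) ?measure0//; apply/seteqP; split=> // t /=.
  by rewrite /ldot big_ord0 add0r => /eqP; rewrite (negbTE c0).
set A := [set t | _]; rewrite /= /add_coordinate /pushforward.
have [a0|a0] := eqVneq (a ord0) 0.
  move=> ac; have {}ac : (c != 0) || [exists i, a (lift ord0 i) != 0].
    case/orP: ac => [cn0|/existsP[k]]; first by rewrite cn0.
    case: (unliftP ord0 k) => [j ->|->].
      by move=> aj; apply/orP; right; apply/existsP; exists j.
    by rewrite a0 eqxx.
  rewrite (_ : _ @^-1` A =
      [set t | ldot (fun i : 'I_d => a (lift ord0 i)) t + c = 0] `*` setT).
    by rewrite product_measure1E ?IH ?mul0e//; exact: measurable_hyperplane.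
  by apply/seteqP; split=> -[t x]; rewrite /A/= ldot_cons a0 mul0r add0r; [|case].
move=> _; rewrite /product_measure1; apply: integral0_eq => t _ /=.
rewrite (_ : xsection _ t =
    [set - ((ldot (fun i : 'I_d => a (lift ord0 i)) t + c) / a ord0)]).
  exact: lebesgue_measure_set1.
apply/seteqP; split=> x; rewrite /xsection/= inE /A/= ldot_cons.
  move=> H; apply: (mulfI a0); rewrite mulrN mulrCA divff// mulr1.
  by apply/eqP; rewrite -addr_eq0 addrA H.
by move=> ->; rewrite mulrN mulrCA divff// mulr1 -addrA addrC subrr.
Qed.

(** * Independence and null sets of pairs *)

Section independence.
Context {d d'} {T : measurableType d} {T' : measurableType d'} {R : realType}.
Context (P : probability T R).

Section pair.
Context {d''} {T'' : measurableType d''} (Y : {RV P >-> T'}) (Z : {RV P >-> T''}).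
Hypothesis YZ : forall A B, measurable A -> measurable B ->
  P (Y @^-1` A `&` Z @^-1` B) = (P (Y @^-1` A) * P (Z @^-1` B))%E.

(** Independence makes the law of the pair a product measure, by uniqueness on rectangles. Its value
    at [E] is the integral of the section measures, which vanish off the null set [N]. *)
Lemma null_by_sections (N : set T') (E : set (T' * T'')) :
  measurable N -> measurable E -> P (Y @^-1` N) = 0%E ->
  (forall y, ~ N y -> distribution P Z (xsection E y) = 0%E) ->
  P [set w | E (Y w, Z w)] = 0%E.
Proof.
move=> mN mE PN0 E0.
have mYZ : measurable_fun setT (fun w => (Y w, Z w)) by exact: measurable_fun_pair.
pose YZm : {mfun T >-> (T' * T'')%type} :=
  HB.pack (fun w => (Y w, Z w)) (isMeasurableFun.Build _ _ _ _ _ mYZ).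
rewrite -[LHS]/(distribution P YZm E).
have prodE A B : measurable A -> measurable B -> distribution P YZm (A `*` B) =
    (distribution P Y A * distribution P Z B)%E by move=> mA mB; rewrite -YZ.
rewrite -(product_measure_unique prodE mE).
rewrite /product_measure1.
rewrite (@ge0_negligible_integral _ _ _ (distribution P Y) setT N)//=.
- by apply: integral0_eq => y [_ Ny]; exact: E0.
- exact: measurable_fun_xsection.
Qed.
End pair.

Section tuple.
Context (n : nat) (X : 'I_n -> {RV P >-> T'}).
Hypothesis X_indep : mutually_independent X.

Definition subfamily k (f : 'I_k -> 'I_n) (w : T) : k.-tuple T' :=
  [tuple X (f i) w | i < k].

Lemma measurable_subfamily k (f : 'I_k -> 'I_n) : measurable_fun setT (subfamily f).
Proof.
apply/measurable_fun_tnthP => i.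
rewrite (_ : _ \o _ = X (f i)); first exact: measurable_funPT.
by apply/funext => w; rewrite /= tnth_mktuple.
Qed.

HB.instance Definition _ k (f : 'I_k -> 'I_n) :=
  isMeasurableFun.Build _ _ _ _ (subfamily f) (measurable_subfamily f).

Let measurable_preimage (j : 'I_n) B : measurable B -> measurable (X j @^-1` B).
Proof. by move=> mB; rewrite -[X in measurable X]setTI; exact: measurable_funPT. Qed.

(** A pi-system argument. For fixed [B], both sides are finite measures in [A]; mutual independence
    gives equality on boxes, which are stable under intersection and generate the product
    sigma-algebra. *)
Lemma subfamily_independent k (f : 'I_k -> 'I_n) (j : 'I_n) :
  injective f -> (forall i, f i != j) ->
  forall A B, measurable A -> measurable B ->
  P (subfamily f @^-1` A `&` X j @^-1` B) =
  (P (subfamily f @^-1` A) * P (X j @^-1` B))%E.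
Proof.
move=> finj fj A B mA mB.
pose box (C : 'I_k -> set T') := [set t : k.-tuple T' | forall i, C i (tnth t i)].
pose G := [set D | exists2 C, (forall i, measurable (C i)) & D = box C].
have boxT : box (fun=> setT) = setT by apply/seteqP; split.
have mG : @measurable _ (k.-tuple T') = <<s G >>.
  apply/seteqP; split.
    apply: smallest_sub; first exact: smallest_sigma_algebra.
    apply: (big_ind (fun F : set (set (k.-tuple T')) => F `<=` <<s G >>)).
    - exact: sub0set.
    - by move=> F F' FG F'G; rewrite subUset; split.
    - move=> i _ _ [C mC <-]; apply: sub_sigma_algebra.
      exists (fun l => if l == i then C else setT) => [l|]; first by case: ifP.
      rewrite setTI; apply/seteqP; split=> [t Ct l|t /(_ i)]; last by rewrite eqxx.
      by case: eqP => [->|].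
  apply: smallest_sub; first exact: sigma_algebra_measurable.
  move=> _ [C mC ->].
  rewrite (_ : box C = \bigcap_(i in setT) ((@tnth k T' ^~ i) @^-1` C i)).
    apply: fin_bigcap_measurable => [|i _]; first exact: finite_finset.
    by rewrite -[X in measurable X]setTI; apply: measurable_tnth.
  by apply/seteqP; split=> t /= Ct i; [move=> _|]; exact: Ct.
have GI : setI_closed G.
  move=> _ _ [C mC ->] [C' mC' ->]; exists (fun i => C i `&` C' i).
    by move=> i; exact: measurableI.
  by apply/seteqP; split=> t /=; [move=> [? ?] i|move=> H; split=> i; have [] := H i].
pose r : {nonneg R} := NngNum (fine_ge0 (measure_ge0 P (X j @^-1` B))).
pose m1 := pushforward (mrestr P (measurable_preimage j mB)) (subfamily f).
pose m2 := mscale r (distribution P (subfamily f)).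
have m12 : forall D, G D -> m1 D = m2 D.
  move=> _ [C mC ->].
  (* One family of events indexed by the whole sample: [C i] at [f i], well defined as [f] is
     injective, and [B] elsewhere, in particular at [j]. *)
  pose D l := if [pick i | f i == l] is Some i then C i else B.
  have Df i : D (f i) = C i.
    rewrite /D; case: pickP => [i' /eqP/finj -> //|/(_ i)]; by rewrite eqxx.
  have Dj : D j = B.
    by rewrite /D; case: pickP => // i; rewrite (negbTE (fj i)).
  have mD l : measurable (D l) by rewrite /D; case: pickP.
  pose J := [set f i | i in 'I_k]%SET.
  have jJ : j \notin J.
    by apply/imsetP => -[i _ ji]; have := fj i; rewrite ji eqxx.
  have JE : subfamily f @^-1` box C = \bigcap_(l in [set` J]) (X l @^-1` D l).
    apply/seteqP; split=> [w Cw l /= /imsetP[i _ ->]|w Hw i].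
      by rewrite Df; have := Cw i; rewrite tnth_mktuple.
    by rewrite tnth_mktuple -Df; apply: Hw; rewrite /= imset_f.
  rewrite /m1 /m2 /mscale /pushforward /mrestr /= /distribution /pushforward fineK.
    have := X_indep (j |: J)%SET mD; rewrite big_setU1//= -X_indep// Dj -JE => <-.
    congr (P _); rewrite JE; apply/seteqP; split=> [w [Hw Hj] l /=|w Hw].
      by rewrite in_setU1 => /orP[/eqP->|]; [rewrite Dj|exact: Hw].
    split=> [l lJ|]; first by apply: Hw; rewrite /= in_setU1; apply/orP; right.
    by rewrite -Dj; apply: Hw; rewrite /= in_setU1 eqxx.
  by apply: fin_num_measure; exact: measurable_preimage.
have : m1 A = m2 A.
  rewrite /m1 /m2; apply: (measure_unique G (fun=> setT) mG GI) => //.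
  - by move=> _; exists (fun=> setT) => //; rewrite boxT.
  - by apply/seteqP; split=> // t _; exists 0%N.
  - move=> _; rewrite /= /pushforward /mrestr /= preimage_setT setTI.
    apply: le_lt_trans (ltry 1); apply: probability_le1.
    exact: measurable_preimage.
rewrite /m1 /m2 /mscale /pushforward /mrestr /= /distribution /pushforward fineK.
  by rewrite muleC.
by apply: fin_num_measure; exact: measurable_preimage.
Qed.

End tuple.
End independence.

(** * Affine dependence of points as a rank condition *)

Section augmented_matrix.
Context {R : realType} (d : nat).

(** If [v A A^T = 0] then [|v A|^2 = 0]. The Gram determinant is polynomial in the entries, which
    makes linear dependence a measurable event. *)
Lemma row_free_gram k m (A : 'M[R]_(k, m)) : row_free A = (\det (A *m A^T) != 0).
Proof.
rewrite -unitfE -unitmxE -row_free_unit; apply/idP/idP => Afree.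
  apply/inj_row_free => v vAA; apply: (row_free_inj Afree); rewrite mul0mx.
  have : (v *m A) *m (v *m A)^T = 0 by rewrite trmx_mul mulmxA -(mulmxA v) vAA mul0mx.
  set u := v *m A => /matrixP/(_ 0 0); rewrite mxE [RHS]mxE.
  under eq_bigr do rewrite [u^T _ _]mxE -expr2.
  move/eqP; rewrite psumr_eq0 => [/allP u0|i _]; last exact: sqr_ge0.
  apply/rowP => i; rewrite [RHS]mxE.
  by have := u0 i (mem_index_enum _); rewrite sqrf_eq0 => /eqP.
apply/inj_row_free => v vA; apply: (row_free_inj Afree).
by rewrite mul0mx mulmxA vA mul0mx.
Qed.

Lemma measurable_det d' (T : measurableType d') k (M : T -> 'M[R]_k) :
  (forall i j, measurable_fun setT (fun t => M t i j)) ->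
  measurable_fun setT (fun t => \det (M t)).
Proof.
move=> mM; apply: measurable_sum => s; apply: measurable_funM => //.
apply: measurable_prod => i _; exact: mM.
Qed.

(* A row [(1, x)] for each point [x], so that affine dependence of the points
   is linear dependence of the rows. *)
Definition augmented k (x : 'I_k -> d.-tuple R) : 'M[R]_(k, 1 + d) :=
  row_mx (const_mx 1) (\matrix_(i, j) tnth (x i) j).

Lemma augmented_mul k (x : 'I_k -> d.-tuple R) (b : 'cV[R]_(1 + d)) i :
  (augmented x *m b) i 0 = ldot (fun j => b (rshift 1 j) 0) (x i) + b (lshift d 0) 0.
Proof.
rewrite mxE big_split_ord/= big_ord1 addrC /augmented; congr (_ + _); last first.
  by rewrite row_mxEl mxE mul1r.
by apply: eq_bigr => j _; rewrite row_mxEr mxE mulrC.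
Qed.

Lemma measurable_row_dependent d' (T : measurableType d') k
    (x : 'I_k -> T -> d.-tuple R) :
  (forall i, measurable_fun setT (x i)) ->
  measurable [set t | ~~ row_free (augmented (x ^~ t))].
Proof.
move=> mx.
have ment i l : measurable_fun setT (fun t => augmented (x ^~ t) i l).
  case: (split_ordP l) => l' ->.
    by under eq_fun do rewrite row_mxEl mxE; exact: measurable_cst.
  under eq_fun do rewrite row_mxEr mxE.
  exact: (measurableT_comp (measurable_tnth l') (mx i)).
have mf : measurable_fun setT
    (fun t => \det (augmented (x ^~ t) *m (augmented (x ^~ t))^T)).
  apply: measurable_det => i j.
  under eq_fun do rewrite mxE.
  apply: measurable_sum => l; apply: measurable_funM; first exact: ment.
  by under eq_fun do rewrite mxE; exact: ment.
have := mf measurableT [set 0] (measurable_set1 0).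
rewrite setTI; congr measurable; apply/seteqP; split=> t /=; rewrite row_free_gram negbK.
  by move=> ->.
by move/eqP.
Qed.

(** Having fewer than [d + 1] rows, [augmented v] annihilates a nonzero vector [(c, a)], chosen
    before the new point. In a dependence relation among the rows of [y], pairing with this vector
    leaves the term of the new row alone, and its coefficient is nonzero since the rows of [v] are
    independent. *)
Lemma row_dependent_hyperplane k (v : 'I_k -> d.-tuple R) : (k < 1 + d)%N ->
  row_free (augmented v) ->
  exists (a : 'I_d -> R) (c : R), (c != 0) || [exists i, a i != 0] /\
    forall y : 'I_k.+1 -> d.-tuple R, (forall i, y (lift ord0 i) = v i) ->
      ~~ row_free (augmented y) -> ldot a (y ord0) + c = 0.
Proof.
move=> kd vfree.
have : kermx (augmented v)^T != 0.
  by rewrite kermx_eq0 /row_free mxrank_tr neq_ltn (leq_ltn_trans (rank_leq_row _) kd).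
case/rowV0Pn => b /sub_kermxP bv b0.
exists (fun j => b^T (rshift 1 j) 0), (b^T (lshift d 0) 0).
have vb : augmented v *m b^T = 0 by rewrite -[augmented v]trmxK -trmx_mul bv trmx0.
split.
  apply: contraT; rewrite negb_or negbK => /andP[/eqP c0 /existsPn a0].
  case/eqP: b0; apply/rowP => i; rewrite [RHS]mxE; case: (split_ordP i) => j ->.
    by move: c0; rewrite mxE (ord1 j).
  by have := a0 j; rewrite negbK mxE => /eqP.
move=> y yv; rewrite -kermx_eq0 => /rowV0Pn[u /sub_kermxP uy u0].
have sub (i : 'I_k) : row (lift ord0 i) (augmented y) = row i (augmented v).
  apply/rowP => l; rewrite [LHS]mxE [RHS]mxE; case: (split_ordP l) => l' ->.
    by rewrite !row_mxEl !mxE.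
  by rewrite !row_mxEr !mxE yv.
have yb (i : 'I_k) : (augmented y *m b^T) (lift ord0 i) 0 = 0.
  have := congr1 (fun M : 'M[R]_(k, 1) => M i 0) vb; rewrite [RHS]mxE => <-.
  by rewrite !augmented_mul yv.
have : u *m (augmented y *m b^T) = 0 by rewrite mulmxA uy mul0mx.
move/matrixP/(_ 0 0); rewrite mxE [RHS]mxE big_ord_recl.
rewrite big1 ?addr0 => [/eqP|i _]; last first.
  by rewrite yb mulr0.
rewrite mulf_eq0 => /orP[/eqP u00|/eqP]; last by rewrite augmented_mul.
pose u' : 'rV[R]_k := \row_i u 0 (lift ord0 i).
have : u' *m augmented v = 0.
  rewrite -uy; apply/rowP => l; rewrite [LHS]mxE [RHS]mxE big_ord_recl u00 mul0r add0r.
  apply: eq_bigr => i _; rewrite mxE; congr (_ * _).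
  by have /rowP/(_ l) := sub i; rewrite !mxE => <-.
move/(congr1 (fun M => M *m pinvmx (augmented v))); rewrite mulmxKp// mul0mx => u'0.
case/eqP: u0; apply/rowP => i; rewrite [RHS]mxE; case: (unliftP ord0 i) => [j ->|->//].
by have /rowP/(_ j) := u'0; rewrite !mxE.
Qed.

End augmented_matrix.

Section almost_sure_independence.
Context {R : realType} (disp : measure_display) (T : measurableType disp).
Context (P : probability T R) (d n : nat) (X : 'I_n -> {RV P >-> d.-tuple R}).
Hypothesis X_indep : mutually_independent X.
Hypothesis X_abscont : forall j : 'I_n, distribution P (X j) `<< lebesgue_tuple d.

Lemma null_row_dependent k (f : 'I_k -> 'I_n) : injective f -> (k <= 1 + d)%N ->
  P [set w | ~~ row_free (augmented (fun i => X (f i) w))] = 0%E.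
Proof.
elim: k f => [|k IH] f finj kd.
  rewrite (_ : [set _ | _] = set0) ?measure0//; apply/seteqP; split=> // w /=.
  by rewrite flatmx0 /row_free mxrank0.
pose g i := f (lift ord0 i).
have ginj : injective g by move=> i j /finj /lift_inj.
pose N := [set v : k.-tuple (d.-tuple R) | ~~ row_free (augmented (tnth v))].
(* [y] puts the new point at index 0 before the earlier ones, so that [E] is an event about the pair
   (earlier points, new point) and [N] is its exceptional set, null by induction. *)
pose y (vx : k.-tuple (d.-tuple R) * d.-tuple R) (i : 'I_k.+1) :=
  if unlift ord0 i is Some i' then tnth vx.1 i' else vx.2.
pose E := [set vx | ~~ row_free (augmented (y vx))].
have mN : measurable N.
  apply: (measurable_row_dependent (x := fun i v => tnth v i)) => i.
  exact: measurable_tnth.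
have mE : measurable E.
  apply: (measurable_row_dependent (x := fun i vx => y vx i)) => i; rewrite /y.
  case: (unlift ord0 i) => [i'|]; last exact: measurable_snd.
  exact: (measurableT_comp (measurable_tnth i') measurable_fst).
have yE w : y (subfamily X g w, X (f ord0) w) = (fun i => X (f i) w).
  apply/funext => i; rewrite /y; case: unliftP => [i' ->|->//].
  by rewrite tnth_mktuple.
have gE w : tnth (subfamily X g w) = (fun i => X (g i) w).
  by apply/funext => i; rewrite tnth_mktuple.
have -> : [set w | ~~ row_free (augmented (fun i => X (f i) w))] =
    [set w | E (subfamily X g w, X (f ord0) w)].
  by apply/seteqP; split=> w; rewrite /E/= yE.
apply: (@null_by_sections _ _ _ _ _ P _ _ (subfamily X g) (X (f ord0)) _ N E mN mE).
- apply: subfamily_independent => // i.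
  by rewrite (inj_eq finj) eq_sym neq_lift.
- rewrite -[RHS](IH g ginj (ltnW kd)); congr (P _).
  by apply/seteqP; split=> w; rewrite /N/= gE.
- move=> v /negP/negPn vfree.
  have [a [c [ac H]]] := row_dependent_hyperplane kd vfree.
  have mH : measurable [set t : d.-tuple R | ldot a t + c = 0].
    exact: measurable_hyperplane.
  have /null_content_dominatesP dom := X_abscont (f ord0).
  have H0 := dom _ mH (null_hyperplane ac).
  apply/eqP; rewrite -measure_le0 -H0; apply: le_measure; rewrite ?inE//.
    exact: measurable_xsection.
  move=> x; rewrite /xsection/= inE => Evx.
  have := H _ _ Evx; rewrite /y unlift_none; apply=> i.
  by rewrite liftK.
Qed.

End almost_sure_independence.

(** If [u S = 0], the sum-of-squares formula makes [u] orthogonal to every centred point. The column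
    [(- u . mean, u)] is then annihilated by the augmented matrix of the [d + 1] chosen points,
    which is square and invertible, so [u = 0]. *)
Lemma sample_cov_unit (R : realType) d n (x : 'I_n -> d.-tuple R)
    (f : 'I_(1 + d) -> 'I_n) :
  row_free (augmented (fun i => x (f i))) ->
  sample_cov (fun j => vec_of_tuple (x j)) \in unitmx.
Proof.
set z := fun j => vec_of_tuple (x j); move=> xfree.
have n0 : (0 < n)%N by exact: leq_ltn_trans (leq0n _) (ltn_ord (f ord0)).
rewrite -row_free_unit; apply/inj_row_free => u uS.
have du j : dotv u^T (z j - sample_mean z) = 0.
  have := sample_cov_form z u^T; rewrite trmxK uS mul0mx mxE => /esym/eqP.
  rewrite mulf_eq0 invr_eq0 pnatr_eq0 -[n == 0%N]negbK -lt0n n0/= psumr_eq0; last first.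
    by move=> *; exact: sqr_ge0.
  by move=> /allP/(_ j (mem_index_enum _)); rewrite sqrf_eq0 => /eqP.
pose b : 'cV[R]_(1 + d) := col_mx (const_mx (- dotv u^T (sample_mean z))) u^T.
have xb : augmented (fun i => x (f i)) *m b = 0.
  apply/matrixP => i j; rewrite (ord1 j) augmented_mul [RHS]mxE.
  rewrite /b col_mxEu [X in _ + X]mxE.
  have := du (f i); rewrite /dotv mulmxBr mxE [X in _ + X]mxE => <-.
  congr (_ - _); rewrite [RHS]mxE; apply: eq_bigr => l _.
  by rewrite col_mxEd !mxE.
have xu : augmented (fun i => x (f i)) \in unitmx by rewrite -row_free_unit.
have /(congr1 (@dsubmx _ _ _ _)) : b = 0 by rewrite -(mulKmx xu b) xb mulmx0.
by rewrite /b col_mxKd linear0 => /(congr1 trmx); rewrite trmxK trmx0.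
Qed.

Unset Implicit Arguments.
Set Strict Implicit.
Set Printing Implicit Defensive.

Theorem theorem4p3 (R : realType) (disp : measure_display)
    (T : measurableType disp) (P : probability T R) (d n : nat)
    (X : 'I_n -> {RV P >-> d.-tuple R})
    (n_ge : (d + 1 <= n)%N)
    (X_indep : mutually_independent X)
    (X_ident : identically_distributed X)
    (X_abscont : forall j : 'I_n, distribution P (X j) `<< lebesgue_tuple d) :
  {ae P, forall w : T, sample_cov (observed X w) \in unitmx} /\
  forall w : T, sample_cov (observed X w) \in unitmx ->
    (gamma `^ (2 + d%:R / 2) *
       (16 * T_stat (observed X w) gamma / (Num.sqrt n%:R * pi `^ (d%:R / 2))))
      @[gamma --> +oo]
    --> mardia_kurtosis (observed X w) - d%:R * (d%:R + 2).
Proof.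
have n1d : (1 + d <= n)%N by rewrite addnC.
have n0 : (0 < n)%N by exact: leq_ltn_trans n1d.
split=> [|w Su]; last exact: cvg_rescaled_T_stat.
(* The measurable null set containing the singular event is the affine dependence of the first
   [d + 1] points. *)
exists [set w | ~~ row_free (augmented (fun i => X (widen_ord n1d i) w))]; split.
- apply: (measurable_row_dependent (x := fun i => X (widen_ord n1d i))) => i.
  exact: measurable_funPT.
- apply: null_row_dependent => // i j /(congr1 val)/= ij; exact: val_inj.
- move=> w /= Su; apply/negP => xfree; apply: Su.
  exact: (sample_cov_unit (x := fun j => X j w) xfree).
Qed.
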